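(* Let $N\ge 3$, $0<R_0<R_1<\infty$, $A=\{x\in\mathbb{R}^N : R_0<|x|<R_1\}$, and suppose that $$p\ \ge\ 2+\frac{2N}{\left(\frac{N-2}{2}\right)^2+R_0^2}.$$ Then every $\mathcal K$-ground state solution of the problem $$-\Delta u+u=|u|^{p-2}u\ \text{ in }A,\qquad u>0\ \text{ in }A,\qquad u=0\ \text{ on }\partial A$$ is nonradial.
   Context: A function on $\overline A$ is called axially symmetric if it only depends on $r=|x|\in[R_0,R_1]$ and $\theta=\arcsin(x_N/|x|)\in[-\pi/2,\pi/2]$; then we write $u(x)=\mathfrak u(r,\theta)$, and $\mathfrak u_\theta$ is the partial derivative in $\theta$. $C^1_0(A)=\{u\in C^1(\overline A): u|_{\partial A}\equiv 0\}$. $\mathcal K$ is the set of $u\in C^1_0(A)$ that are axially symmetric, satisfy $u\ge 0$ in $\overline A$, $\mathfrak u(r,\theta)=\mathfrak u(r,-\theta)$ and $\mathfrak u_\theta(r,\theta)\le 0$ for $(r,\theta)\in[R_0,R_1]\times(0,\pi/2)$. $I:C^1_0(A)\to\mathbb R$, $I(u)=\frac12\int_A(|\nabla u|^2+u^2)\,dx-\frac1p\int_A|u|^p\,dx$, and $\mathcal N_{\mathcal K}=\{u\in\mathcal K: u\not\equiv 0,\ I'(u)u=0\}$. A $\mathcal K$-ground state solution is a minimizer $u\in\mathcal N_{\mathcal K}$ of $I|_{\mathcal N_{\mathcal K}}$. Nonradial means not a function of $|x|$ alone. *)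

(* Defs.v *)
From HB Require Import structures.
From mathcomp Require Import all_boot all_order all_algebra.
From mathcomp Require Import all_classical all_reals all_analysis.

Set Implicit Arguments.
Unset Strict Implicit.
Unset Printing Implicit Defensive.

Import Order.TTheory GRing.Theory Num.Theory.
Import numFieldNormedType.Exports.

Local Open Scope classical_set_scope.
Local Open Scope ring_scope.

(* The library has no measurable structure on row vectors, so N-dimensional
   Lebesgue measure is built on N.-tuple R, whose measurable sets are generated
   by the coordinates: start from the point mass on the one point of R^0, and
   push the product measure forward along R * R^N -> R^(N+1). *)
Section lebesgue_tuple_step.
Variables (R : realType) (N : nat).
Local Notation RT := (measurableTypeR R).
Variable mu : {sigma_finite_measure set (N.-tuple RT) -> \bar R}.

Definition cons_pair (xt : RT * N.-tuple RT) : N.+1.-tuple RT :=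
  [tuple of xt.1 :: xt.2].

Let measurable_cons_pair : measurable_fun [set: RT * N.-tuple RT] cons_pair.
Proof. exact: measurable_cons. Qed.

Let measurable_uncons : measurable_fun [set: N.+1.-tuple RT]
  (fun t => (thead t, [tuple of behead t]) : RT * N.-tuple RT).
Proof.
apply/measurable_fun_pair; last exact: measurable_behead.
exact: measurable_tnth.
Qed.

Definition lebesgue_tuple_step : set (N.+1.-tuple RT) -> \bar R :=
  pushforward (@lebesgue_measure R \x mu)%E cons_pair.

Let step0 : (lebesgue_tuple_step set0 = 0)%E.
Proof. by rewrite /lebesgue_tuple_step /pushforward preimage_set0 measure0. Qed.

Let step_ge0 A : (0 <= lebesgue_tuple_step A)%E.
Proof. exact: measure_ge0. Qed.

Let step_sigma_additive : semi_sigma_additive lebesgue_tuple_step.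
Proof.
move=> F mF tF mUF; rewrite /lebesgue_tuple_step /pushforward preimage_bigcup.
apply: measure_semi_sigma_additive.
- by move=> n; rewrite -[X in measurable X]setTI; exact: measurable_cons_pair.
- apply/trivIsetP => /= i j _ _ ij; rewrite -preimage_setI.
  by move/trivIsetP : tF => /(_ _ _ _ _ ij) ->//; rewrite preimage_set0.
- rewrite -preimage_bigcup -[X in measurable X]setTI.
  exact: measurable_cons_pair.
Qed.

HB.instance Definition _ := isMeasure.Build _ _ _
  lebesgue_tuple_step step0 step_ge0 step_sigma_additive.

Let step_sigma_finite : sigma_finite setT lebesgue_tuple_step.
Proof.
have /sigma_finiteP[F [TF ndF Foo]] := sigma_finiteT (@lebesgue_measure R).
have /sigma_finiteP[G [TG ndG Goo]] := sigma_finiteT mu.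
pose g (t : N.+1.-tuple RT) := (thead t, [tuple of behead t]) : RT * N.-tuple RT.
have gK xt : g (cons_pair xt) = xt.
  by case: xt => x t; congr pair; apply/val_inj.
exists (fun k => g @^-1` (F k `*` G k)).
  rewrite -preimage_bigcup (_ : \bigcup_k _ = setT) ?preimage_setT//.
  apply/seteqP; split=> // -[x y] _.
  have [i _ Fix] : (\bigcup_i F i) x by rewrite -TF.
  have [j _ Gjy] : (\bigcup_j G j) y by rewrite -TG.
  exists (maxn i j) => //; split => /=.
  - by move: x Fix; exact/subsetPset/ndF/leq_maxl.
  - by move: y Gjy; exact/subsetPset/ndG/leq_maxr.
move=> k; have [mF Fk] := Foo k; have [mG Gk] := Goo k; split.
  rewrite -[X in measurable X]setTI; apply: measurable_uncons => //.
  exact: measurableX.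
rewrite /lebesgue_tuple_step /pushforward -comp_preimage.
rewrite (_ : _ @^-1` _ = F k `*` G k).
  by rewrite product_measure1E// lte_mul_pinfty// ge0_fin_numE.
have -> : g \o cons_pair = id by apply/funext => xt /=; rewrite gK.
by rewrite preimage_id.
Qed.

HB.instance Definition _ := Measure_isSigmaFinite.Build _ _ _
  lebesgue_tuple_step step_sigma_finite.

End lebesgue_tuple_step.

Fixpoint lebesgue_tuple (R : realType) (N : nat) :
    {sigma_finite_measure set (N.-tuple (measurableTypeR R)) -> \bar R} :=
  if N is N'.+1 then lebesgue_tuple_step (lebesgue_tuple R N')
  else dirac [tuple].

Section EuclideanSpace.
Variables (R : realType) (N : nat).
Implicit Types (x : 'rV[R]_N) (u : 'rV[R]_N -> R) (D : set 'rV[R]_N).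

Definition rV_of_tuple (t : N.-tuple (measurableTypeR R)) : 'rV[R]_N :=
  \row_i tnth t i.

Definition integral_rV D u : R :=
  (\int[lebesgue_tuple R N]_(t in rV_of_tuple @^-1` D) u (rV_of_tuple t))%R.

(* The library norm `|x| on row vectors is the sup norm; it is used below only
   through the topology and the derivatives it induces. *)
Definition enorm x : R := Num.sqrt (\sum_i x 0 i ^+ 2).

Definition partial (i : 'I_N) u x : R := 'D_(delta_mx 0 i) u x.

Definition sqgrad u x : R := \sum_i partial i u x ^+ 2.

(* u is C^1 in the open set D, and u and its first partial derivatives extend
   continuously to the closure of D. *)
Definition C1_closure D u : Prop :=
  [/\ {within closure D, continuous u},
      forall x, D x -> differentiable u x &
      forall i, exists g, {within closure D, continuous g} /\
                          forall x, D x -> g x = partial i u x].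

Definition C10 D u : Prop :=
  C1_closure D u /\ forall x, (closure D `\` D°) x -> u x = 0.

Definition annulus (R0 R1 : R) : set 'rV[R]_N :=
  [set x | R0 < enorm x < R1].

Definition energy (p : R) D u : R :=
  2^-1 * integral_rV D (fun x => sqgrad u x + u x ^+ 2)
  - p^-1 * integral_rV D (fun x => `|u x| `^ p).

(* I'(u)v = l, with I'(u)v the derivative of I at u in the direction v. *)
Definition is_denergy (p : R) D u (v : 'rV[R]_N -> R) (l : R) : Prop :=
  is_derive (0 : R) (1 : R) (fun t : R => energy p D (fun x => u x + t * v x)) l.

Definition radial D u : Prop :=
  exists g : R -> R, forall x, D x -> u x = g (enorm x).

End EuclideanSpace.

(* The axis of symmetry is the last one, so the dimension is written n.+1. *)
Section Annulus.
Variables (R : realType) (n : nat).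
Implicit Types (u : 'rV[R]_n.+1 -> R).

Definition polar_angle (x : 'rV[R]_n.+1) : R := asin (x 0 ord_max / enorm x).

(* The values of w on [R0, R1] * [-pi/2, pi/2] are determined by u, since
   (r, theta) is onto this rectangle. *)
Definition axial_profile (R0 R1 : R) u (w : R -> R -> R) : Prop :=
  forall x, closure (@annulus R n.+1 R0 R1) x ->
    u x = w (enorm x) (polar_angle x).

(* For u in C10, w r is automatically derivable on ]-pi/2, pi/2[; derivability is
   stated so that derive1 is meaningful on its face. *)
Definition coneK (R0 R1 : R) u : Prop :=
  [/\ C10 (annulus R0 R1) u,
      forall x, closure (annulus R0 R1) x -> 0 <= u x &
      exists w : R -> R -> R,
        [/\ axial_profile R0 R1 u w,
            forall r theta : R, R0 <= r <= R1 ->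
              - (pi / 2) <= theta <= pi / 2 -> w r theta = w r (- theta) &
            forall r theta : R, R0 <= r <= R1 -> 0 < theta < pi / 2 ->
              derivable (w r) theta 1 /\ derive1 (w r) theta <= 0]].

Definition nehariK (p R0 R1 : R) u : Prop :=
  [/\ coneK R0 R1 u,
      exists2 x, closure (annulus R0 R1) x & u x != 0 &
      is_denergy p (annulus R0 R1) u u 0].

Definition K_ground_state (p R0 R1 : R) u : Prop :=
  nehariK p R0 R1 u /\
  forall v, nehariK p R0 R1 v ->
    energy p (annulus R0 R1) u <= energy p (annulus R0 R1) v.

End Annulus.

(* Main.v *)
(* Suppose that a K-ground state u is radial, u = g(|x|), and let
   Y = 1 - N x_N^2 / |x|^2, a spherical harmonic of degree 2, hence with
   eigenvalue 2 N. Since Y decreases away from the equator, u (1 + s Y) lies in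
   the cone K for small s >= 0, and so does its multiple on the Nehari set. With
   a = \int |grad u|^2 + u^2 = \int u^p, c = \int u^2 / |x|^2 and m the mean of
   Y^2 over the sphere, the quadratic part of the energy of u (1 + s Y) is
   exactly a + s^2 m (a + 2 N c), while its p-th power integral is at least
   a (1 + k m s^2) for any k < p (p - 1) / 2 and small s. Hardy's inequality and
   |x| > R0 give a > (((N - 2) / 2)^2 + R0^2) c, so the bound on p yields
   2 N c < (p - 2) a, which makes the energy on the Nehari set drop below that
   of u.

   The moments of x_N over spheres come from the invariance of Lebesgue measure
   under rotations of coordinate planes, each a product of three shears; Hardy's
   inequality comes from differentiating \int F(l x) dx = l^(-N) \int F dx at
   l = 1, which is the divergence theorem for the field x F. *)
Require Import Defs.
From mathcomp Require Import all_boot all_order all_algebra.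
From mathcomp Require Import all_classical all_reals all_analysis.
From mathcomp Require Import measurable_realfun ring lra.
Import Order.TTheory GRing.Theory Num.Theory.
Import numFieldNormedType.Exports.
Local Open Scope classical_set_scope.
Local Open Scope ring_scope.

Set Implicit Arguments.
Unset Strict Implicit.
Unset Printing Implicit Defensive.

(** * Affine changes of variables *)

(** The threshold comes from one comparison. On the Nehari set the energy is 1/2 - 1/p times the
    quadratic part, and scaling u (1 + s Y) onto that set lowers this part as soon as (1 + m (1 + 2
    N c / a) s^2)^(p / 2) < 1 + k m s^2. To order s^2 this reads p (1 + 2 N c / a) / 2 < k, and some
    k < p (p - 1) / 2 satisfies it exactly when 1 + 2 N c / a < p - 1. No term of order s appears
    because Y has mean zero on spheres.

    The perturbation multiplies u instead of being added to it: the p-th power then factors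
    pointwise into u^p and (1 + s Y)^p, so a Taylor inequality in one real variable suffices,
    uniformly up to the boundary where u vanishes, and the energy is never differentiated twice. The
    gradient splits as well, since u is radial and Y is constant along rays.

    Integrals are never written in polar coordinates: functions of |x| serve as weights, and
    averages over spheres become identities between weighted moments. *)

Section lebesgue_measure_affine.
Variable R : realType.
Local Notation RT := (measurableTypeR R).
Local Notation leb := (@lebesgue_measure R).

(** By uniqueness of Lebesgue measure: the pushforward gives half-open intervals their length. The
    same argument serves for dilations. *)
Lemma lebesgue_measure_translate (c : R) (A : set RT) : measurable A ->
  leb ((fun x => x + c) @^-1` A) = leb A.
Proof.
move=> mA; rewrite -[LHS]/(pushforward leb (fun x : RT => x + c : RT) A).
apply/esym/lebesgue_measure_unique => //=.
  exact: measurable_funD.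
move=> mt _ [[a b]] _ <-; rewrite /pushforward.
rewrite (_ : _ @^-1` _ = `](a - c), (b - c)]%classic); last first.
  by apply/seteqP; split => x /=; rewrite !in_itv/= ltrBlDr lerBrDr.
rewrite !lebesgue_measure_itv/= !lte_fin ltrD2r.
by case: ifP => // _; rewrite -!EFinD; congr EFin; ring.
Qed.

Lemma lebesgue_measure_scale (c : R) (A : set RT) : 0 < c -> measurable A ->
  leb A = (c%:E * leb ((fun x => (c * x)%R) @^-1` A))%E.
Proof.
move=> c0 mA; have c0' := ltW c0; pose k := NngNum c0'.
rewrite -[RHS]/(pushforward (mscale k leb) (fun x : RT => (c * x)%R : RT) A).
apply: lebesgue_measure_unique => //=.
  exact: measurable_funM.
move=> mc _ [[a b]] _ <-; rewrite /pushforward /mscale/=.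
rewrite (_ : _ @^-1` _ = `](a / c), (b / c)]%classic); last first.
  apply/seteqP; split => x /=; rewrite !in_itv/=.
    by rewrite ltr_pdivrMr// ler_pdivlMr// ![x * c]mulrC.
  by rewrite ltr_pdivrMr// ler_pdivlMr// ![x * c]mulrC.
rewrite !lebesgue_measure_itv/= !lte_fin ltr_pM2r ?invr_gt0//.
case: ifP => _; last by rewrite mule0.
by rewrite -!EFinD -EFinM; congr EFin; rewrite mulrBr !(mulrC c) !divfK ?gt_eqF.
Qed.

End lebesgue_measure_affine.

Section lebesgue_tuple_affine.
Variable R : realType.
Local Notation RT := (measurableTypeR R).
Local Notation leb := (@lebesgue_measure R).

Lemma measurable_cons_pair N :
  measurable_fun [set: RT * N.-tuple RT] (@cons_pair R N).
Proof. exact: measurable_cons. Qed.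

Lemma cons_xsectionE N (A : set (N.+1.-tuple RT)) (x : RT) :
  [set t | A (cons_pair (x, t))] = xsection (@cons_pair R N @^-1` A) x.
Proof. by apply/seteqP; split => t; rewrite /xsection/= inE. Qed.

Lemma cons_ysectionE N (A : set (N.+1.-tuple RT)) (t : N.-tuple RT) :
  [set x | A (cons_pair (x, t))] = ysection (@cons_pair R N @^-1` A) t.
Proof. by apply/seteqP; split => x; rewrite /ysection/= inE. Qed.

Lemma lebesgue_tupleS N (A : set (N.+1.-tuple RT)) :
  lebesgue_tuple R N.+1 A =
  (\int[leb]_x lebesgue_tuple R N [set t | A (cons_pair (x, t))])%E.
Proof.
by apply: eq_integral => x _ /=; rewrite cons_xsectionE.
Qed.

(** The product measure built in the other order agrees on rectangles, hence everywhere by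
    uniqueness. Slicing along the first axis is what gives access to the one-dimensional measure. *)
Lemma lebesgue_tupleS_swap N (A : set (N.+1.-tuple RT)) : measurable A ->
  lebesgue_tuple R N.+1 A =
  (\int[lebesgue_tuple R N]_t leb [set x | A (cons_pair (x, t))])%E.
Proof.
move=> mA.
have mB : measurable (@cons_pair R N @^-1` A).
  by rewrite -[X in measurable X]setTI; exact: measurable_cons_pair.
rewrite [LHS](@product_measure_unique _ _ _ _ _ _ _ (leb \x^ lebesgue_tuple R N)%E)//.
  by apply: eq_integral => t _ /=; rewrite cons_ysectionE.
by move=> B C mB' mC; exact: product_measure2E.
Qed.

(** The amount [h] is an arbitrary function and not a linear form, so that the class of these maps
    is stable under freezing a coordinate, as the induction on the dimension requires. *)
Definition shift_coord N (i : 'I_N) (h : N.-tuple RT -> R) (t : N.-tuple RT) :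
  N.-tuple RT := [tuple if j == i then tnth t j + h t else tnth t j | j < N].

Lemma measurable_tnthT N (j : 'I_N) :
  measurable_fun [set: N.-tuple RT] (fun t => tnth t j : R).
Proof. exact: measurable_tnth. Qed.

Lemma measurable_shift_coord N (i : 'I_N) h :
  measurable_fun [set: N.-tuple RT] h ->
  measurable_fun [set: N.-tuple RT] (shift_coord i h).
Proof.
move=> mh; apply/measurable_fun_tnthP => j.
rewrite [X in measurable_fun _ X](_ : _ =
  (fun t => if j == i then tnth t j + h t else tnth t j : RT)); last first.
  by apply/funext => t /=; rewrite tnth_mktuple.
case: (j == i); last exact: measurable_tnthT.
by apply: measurable_funD => //; exact: measurable_tnthT.
Qed.

Lemma measurable_preimage d d' (X : measurableType d) (Y : measurableType d')
    (f : X -> Y) (A : set Y) :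
  measurable_fun [set: X] f -> measurable A -> measurable (f @^-1` A).
Proof. by move=> mf mA; rewrite -[X in measurable X]setTI; exact: mf. Qed.

Lemma measurable_cons_pair1 N (x : R) :
  measurable_fun [set: N.-tuple RT] (fun t => cons_pair (x : RT, t)).
Proof. exact: (measurable_cons (f := cst (x : RT)) (g := id)). Qed.

Lemma measurable_cons_pair2 N (t : N.-tuple RT) :
  measurable_fun [set: RT] (fun x : RT => cons_pair (x, t)).
Proof. exact: (measurable_cons (f := id) (g := cst t)). Qed.

Lemma shift_coord_cons0 N h (x : RT) (t : N.-tuple RT) :
  shift_coord ord0 h (cons_pair (x, t)) = cons_pair (x + h (cons_pair (x, t)), t).
Proof.
apply: eq_from_tnth => j; rewrite tnth_mktuple.
case: (unliftP ord0 j) => [k ->|->]; last by rewrite eqxx !tnth0.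
by rewrite [_ == ord0]eq_sym (negbTE (neq_lift _ _)) !tnthS.
Qed.

Lemma shift_coord_consS N (i : 'I_N) h (x : RT) (t : N.-tuple RT) :
  shift_coord (lift ord0 i) h (cons_pair (x, t)) =
  cons_pair (x, shift_coord i (fun t => h (cons_pair (x, t))) t).
Proof.
apply: eq_from_tnth => j; rewrite tnth_mktuple.
case: (unliftP ord0 j) => [k ->|->]; last by rewrite (negbTE (neq_lift _ _)) !tnth0.
by rewrite !tnthS tnth_mktuple (inj_eq (lift_inj)).
Qed.

(** Cavalieri's principle. If [i] is not the first coordinate, slices at a fixed first coordinate
    are shifted in one dimension less. If it is the first, slices along the first axis are
    translated, by an amount that is constant on each of them because [h] ignores coordinate [i]. *)
Lemma lebesgue_tuple_shift_coord N (i : 'I_N) h (A : set (N.-tuple RT)) :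
  measurable_fun [set: N.-tuple RT] h ->
  (forall t t', (forall j, j != i -> tnth t j = tnth t' j) -> h t = h t') ->
  measurable A ->
  lebesgue_tuple R N (shift_coord i h @^-1` A) = lebesgue_tuple R N A.
Proof.
elim: N => [|N IH] in i h A *; first by case: i.
move=> mh hi mA; have mSA := measurable_preimage (measurable_shift_coord i mh) mA.
case: (unliftP ord0 i) => [k ik|i0].
  rewrite !lebesgue_tupleS; apply: eq_integral => x _.
  rewrite -[RHS](IH k (fun t => h (cons_pair (x, t)))).
  - congr (lebesgue_tuple R N _); apply/seteqP.
    by split => t; rewrite /preimage/= ik shift_coord_consS.
  - by apply: (measurableT_comp mh); exact: measurable_cons_pair1.
  - move=> t t' tt'; apply: hi => j; rewrite ik.
    case: (unliftP ord0 j) => [l ->|->]; last by rewrite !tnth0.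
    by rewrite (inj_eq lift_inj) !tnthS; exact: tt'.
  - by apply: measurable_preimage mA; exact: measurable_cons_pair1.
rewrite !lebesgue_tupleS_swap//; apply: eq_integral => t _.
rewrite -[RHS](@lebesgue_measure_translate _ (h (cons_pair (0, t)))); last first.
  by apply: measurable_preimage mA; exact: measurable_cons_pair2.
congr (leb _); apply/seteqP; split => x /=; rewrite i0 shift_coord_cons0;
  rewrite (hi (cons_pair (x, t)) (cons_pair (0, t)))// => j;
  rewrite i0; case: (unliftP ord0 j) => [l ->|->]; rewrite ?eqxx// !tnthS//.
Qed.

Definition scale_tuple N (c : R) (t : N.-tuple RT) : N.-tuple RT :=
  [tuple c * tnth t j : RT | j < N].

Lemma measurable_scale_tuple N c :
  measurable_fun [set: N.-tuple RT] (@scale_tuple N c).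
Proof.
apply/measurable_fun_tnthP => j.
rewrite [X in measurable_fun _ X](_ : _ = (fun t => c * tnth t j : RT)); last first.
  by apply/funext => t /=; rewrite tnth_mktuple.
by apply: measurable_funM => //; exact: measurable_tnthT.
Qed.

Lemma scale_tuple_cons N c (x : RT) (t : N.-tuple RT) :
  scale_tuple c (cons_pair (x, t)) = cons_pair (c * x : RT, scale_tuple c t).
Proof.
apply: eq_from_tnth => j; rewrite tnth_mktuple.
case: (unliftP ord0 j) => [k ->|->]; last by rewrite !tnth0.
by rewrite !tnthS tnth_mktuple.
Qed.

Lemma lebesgue_tuple_scale N (c : R) (A : set (N.-tuple RT)) :
  0 < c -> measurable A ->
  lebesgue_tuple R N A =
  ((c ^+ N)%:E * lebesgue_tuple R N (scale_tuple c @^-1` A))%E.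
Proof.
move=> c0; elim: N => [|N IH] in A *; move=> mA.
  rewrite expr0 mul1e; congr (lebesgue_tuple R 0 _).
  by apply/seteqP; split => t /=; rewrite (tuple0 t) (tuple0 (scale_tuple _ _)).
have mB : measurable (scale_tuple c @^-1` A).
  by apply: measurable_preimage mA; exact: measurable_scale_tuple.
(* [B] is the preimage of [A] when all coordinates but the first are scaled. It separates the factor
   c^N, found on slices at a fixed first coordinate, from the last factor c, found on slices along
   the first axis. *)
pose B : set (N.+1.-tuple RT) := [set t | A (cons_pair (thead t, scale_tuple c [tuple of behead t]))].
have mB' : measurable B.
  apply: measurable_preimage mA.
  apply: measurable_cons; first exact: measurable_tnth.
  apply: (measurableT_comp (@measurable_scale_tuple _ _)).
  exact: measurable_behead.
have BE x t : B (cons_pair (x, t)) = A (cons_pair (x, scale_tuple c t)).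
  by rewrite /B/= theadE; congr (A (cons_pair (_, scale_tuple c _))); exact/val_inj.
transitivity ((c ^+ N)%:E * lebesgue_tuple R N.+1 B)%E.
  rewrite !lebesgue_tupleS -ge0_integralZl//.
  - apply: eq_integral => x _; rewrite [LHS]IH.
      by congr (_ * lebesgue_tuple R N _)%E; apply/seteqP; split => t /=; rewrite BE.
    by apply: measurable_preimage mA; exact: measurable_cons_pair1.
  - under eq_fun do rewrite cons_xsectionE.
    apply: (@measurable_fun_xsection _ _ _ _ _ (lebesgue_tuple R N)).
    by apply: measurable_preimage mB'; exact: measurable_cons_pair.
  - by rewrite lee_fin exprn_ge0// ltW.
rewrite exprSr EFinM -muleA; congr (_ * _)%E.
rewrite !lebesgue_tupleS_swap// -ge0_integralZl//.
- apply: eq_integral => t _; rewrite [LHS](@lebesgue_measure_scale _ c)//.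
    by congr (_ * leb _)%E; apply/seteqP; split => x /=; rewrite BE scale_tuple_cons.
  by apply: measurable_preimage mB'; exact: measurable_cons_pair2.
- under eq_fun do rewrite cons_ysectionE.
  apply: (@measurable_fun_ysection _ _ _ _ _ leb).
  by apply: measurable_preimage mB; exact: measurable_cons_pair.
- by rewrite lee_fin ltW.
Qed.

End lebesgue_tuple_affine.

(** * Integrals of bounded measurable functions *)

Section change_of_variables.
Local Open Scope ereal_scope.
Context d (T : measurableType d) (R : realType).
Variables (mu : {measure set T -> \bar R}) (phi : T -> T) (k : R).
Hypotheses (mphi : measurable_fun [set: T] phi) (k_gt0 : (0 < k)%R).
Hypothesis mu_phi : forall A, measurable A -> mu A = k%:E * mu (phi @^-1` A).

(** The hypothesis on [phi] says that [mu] is [k] times its own pushforward. Rotations are the case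
    k = 1, dilations by l the case k = l^N. *)
Lemma ge0_integral_scaling D (f : T -> \bar R) : measurable D ->
  measurable_fun D f -> {in D, forall x, 0 <= f x} ->
  \int[mu]_(x in D) f x = k%:E * \int[mu]_(x in phi @^-1` D) f (phi x).
Proof.
move=> mD mf f0; have k0 := ltW k_gt0; pose c := NngNum k0.
rewrite -(ge0_integral_pushforward mphi mu mD mf f0).
rewrite -(@ge0_integral_mscale _ _ _ (pushforward mu phi) _ mD c)//.
  by apply: eq_measure_integral => A mA AD; exact: mu_phi.
by move=> x Dx; apply: f0; rewrite inE.
Qed.

Lemma ge0_Rintegral_scaling D (f : T -> R) : measurable D ->
  measurable_fun D f -> {in D, forall x, (0 <= f x)%R} ->
  (\int[mu]_(x in D) f x = k * \int[mu]_(x in phi @^-1` D) f (phi x))%R.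
Proof.
move=> mD mf f0; rewrite /Rintegral ge0_integral_scaling//; first last.
  exact/measurable_EFinP.
have : 0 <= \int[mu]_(x in phi @^-1` D) (f (phi x))%:E.
  by apply: integral_ge0 => x Dx; rewrite lee_fin f0// inE.
(* An infinite integral is read as 0 on both sides, so no integrability is required. *)
case: (integral _ _ _) => [r _|_|]//.
by rewrite gt0_muley ?lte_fin//= mulr0.
Qed.

End change_of_variables.

Section bounded_measurable.
Context d (T : measurableType d) (R : realType).
Variables (mu : {measure set T -> \bar R}) (D : set T).
Hypotheses (mD : measurable D) (finD : (mu D < +oo)%E).
Implicit Types F G : T -> R.

(** This class takes the place of integrability: it is closed under products, and on a set of finite
    measure, such as a shell, it implies integrability. *)
Definition bounded_measurable F :=
  measurable_fun D F /\ exists M, forall x, D x -> `|F x| <= M.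

Lemma bounded_measurable_integrable F :
  bounded_measurable F -> mu.-integrable D (EFin \o F).
Proof.
move=> [mF [M FM]]; apply: measurable_bounded_integrable => //.
exists M; split; rewrite ?num_real// => y My x Dx.
exact: le_trans (FM _ Dx) (ltW My).
Qed.

Lemma bounded_measurable_cst c : bounded_measurable (fun=> c).
Proof. by split; [exact: measurable_cst|exists `|c|]. Qed.

Lemma bounded_measurableD F G : bounded_measurable F -> bounded_measurable G ->
  bounded_measurable (fun x => F x + G x).
Proof.
move=> [mF [M FM]] [mG [M' GM]]; split; first exact: measurable_funD.
by exists (M + M') => x Dx; rewrite (le_trans (ler_normD _ _))// lerD ?FM ?GM.
Qed.

Lemma bounded_measurableM F G : bounded_measurable F -> bounded_measurable G ->
  bounded_measurable (fun x => F x * G x).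
Proof.
move=> [mF [M FM]] [mG [M' GM]]; split; first exact: measurable_funM.
by exists (M * M') => x Dx; rewrite normrM ler_pM ?FM ?GM.
Qed.

Lemma bounded_measurableZ c F : bounded_measurable F ->
  bounded_measurable (fun x => c * F x).
Proof. by apply: bounded_measurableM; exact: bounded_measurable_cst. Qed.

Lemma bounded_measurableX F n : bounded_measurable F ->
  bounded_measurable (fun x => F x ^+ n).
Proof.
move=> bF; elim: n => [|n IH].
  by under [X in bounded_measurable X]eq_fun do rewrite expr0; exact: bounded_measurable_cst.
by under [X in bounded_measurable X]eq_fun do rewrite exprS; exact: bounded_measurableM.
Qed.

Lemma RintegralD_bounded F G : bounded_measurable F -> bounded_measurable G ->
  \int[mu]_(x in D) (F x + G x) =
  \int[mu]_(x in D) F x + \int[mu]_(x in D) G x.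
Proof. by move=> bF bG; apply: RintegralD => //; exact: bounded_measurable_integrable. Qed.

Lemma RintegralZ_bounded c F : bounded_measurable F ->
  \int[mu]_(x in D) (c * F x) = c * \int[mu]_(x in D) F x.
Proof. by move=> bF; apply: RintegralZl => //; exact: bounded_measurable_integrable. Qed.

Lemma le_Rintegral_bounded F G : bounded_measurable F -> bounded_measurable G ->
  (forall x, D x -> F x <= G x) ->
  \int[mu]_(x in D) F x <= \int[mu]_(x in D) G x.
Proof. by move=> bF bG; apply: le_Rintegral => //; exact: bounded_measurable_integrable. Qed.

Lemma Rintegral_sum_bounded (I : finType) (F : I -> T -> R) :
  (forall i, bounded_measurable (F i)) ->
  \int[mu]_(x in D) (\sum_i F i x) = \sum_i \int[mu]_(x in D) F i x.
Proof.
move=> bF; suff : bounded_measurable (fun x => \sum_i F i x) /\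
    \int[mu]_(x in D) (\sum_i F i x) = \sum_i \int[mu]_(x in D) F i x by case.
elim: (index_enum I) => [|i s [bs IH]].
  under [X in bounded_measurable X]eq_fun do rewrite big_nil.
  under eq_Rintegral do rewrite big_nil.
  by split; [exact: bounded_measurable_cst|rewrite big_nil Rintegral_cst// mul0r].
under [X in bounded_measurable X]eq_fun do rewrite big_cons.
under eq_Rintegral do rewrite big_cons.
by split; [exact: bounded_measurableD|rewrite RintegralD_bounded// big_cons IH].
Qed.

End bounded_measurable.

Section lebesgue_tuple_box.
Variable R : realType.
Local Notation RT := (measurableTypeR R).
Local Notation leb := (@lebesgue_measure R).

Lemma measurable_box N (A : 'I_N -> set RT) : (forall i, measurable (A i)) ->
  measurable [set t : N.-tuple RT | forall i, A i (tnth t i)].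
Proof.
move=> mA; rewrite (_ : [set _ | _] =
    \big[setI/setT]_(i < N) ((fun t : N.-tuple RT => tnth t i : RT) @^-1` A i)).
  apply: bigsetI_measurable => i _.
  exact: (measurable_preimage (measurable_tnth i) (mA i)).
apply/seteqP; split => t /=; rewrite -bigcap_seq/=.
  by move=> At i _; exact: At.
by move=> At i; apply: At; rewrite /= mem_index_enum.
Qed.

Lemma lebesgue_tuple_box N (A : 'I_N -> set RT) : (forall i, measurable (A i)) ->
  lebesgue_tuple R N [set t | forall i, A i (tnth t i)] =
  (\prod_(i < N) leb (A i))%E.
Proof.
elim: N => [|N IH] in A *; move=> mA.
  rewrite big_ord0 /= diracE mem_set//=; by case.
rewrite big_ord_recl -IH; last by [].
rewrite -product_measure1E; [|by []|exact: (measurable_box (A := fun i => A (lift ord0 i)))].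
rewrite -[LHS]/((leb \x lebesgue_tuple R N)%E (@cons_pair R N @^-1` _)).
congr (_ _).
apply/seteqP; split => -[x t] /=.
  by move=> h; split; [have := h ord0; rewrite tnth0|move=> i; have := h (lift ord0 i); rewrite tnthS].
move=> [h0 h] i; case: (unliftP ord0 i) => [j ->|->]; first by rewrite tnthS.
by rewrite tnth0.
Qed.

End lebesgue_tuple_box.

(** * Spherical shells and their moments *)

Section shell.
Variables (R : realType) (N : nat).
Local Notation RT := (measurableTypeR R).
Local Notation T := (N.-tuple RT).
Local Notation mu := (lebesgue_tuple R N).

Lemma coord_le_enorm (x : 'rV[R]_N) i : `|x 0 i| <= enorm x.
Proof.
rewrite -sqrtr_sqr ler_wsqrtr// (bigD1 i)//= lerDl.
by apply: sumr_ge0 => j _; exact: sqr_ge0.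
Qed.

Lemma enorm_sqr (x : 'rV[R]_N) : enorm x ^+ 2 = \sum_i x 0 i ^+ 2.
Proof. by rewrite sqr_sqrtr//; apply: sumr_ge0 => j _; exact: sqr_ge0. Qed.

Lemma enorm_ge0 (x : 'rV[R]_N) : 0 <= enorm x.
Proof. exact: sqrtr_ge0. Qed.

Lemma enormZ c (x : 'rV[R]_N) : 0 <= c -> enorm (c *: x) = c * enorm x.
Proof.
move=> c0; rewrite /enorm.
under eq_bigr do rewrite mxE exprMn.
by rewrite -mulr_sumr sqrtrM ?sqr_ge0// sqrtr_sqr ger0_norm.
Qed.

Definition radius (t : T) : R := enorm (rV_of_tuple t).

Lemma radiusE t : radius t = Num.sqrt (\sum_i tnth t i ^+ 2).
Proof. by rewrite /radius /enorm; under eq_bigr do rewrite mxE. Qed.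

Lemma radius_sqr t : radius t ^+ 2 = \sum_i tnth t i ^+ 2.
Proof. by rewrite enorm_sqr; under eq_bigr do rewrite mxE. Qed.

Lemma radius_scale_tuple c t : 0 <= c -> radius (scale_tuple c t) = c * radius t.
Proof.
move=> c0; rewrite /radius -enormZ//; congr enorm.
by apply/rowP => i; rewrite !mxE tnth_mktuple.
Qed.

Lemma measurable_radius : measurable_fun [set: T] radius.
Proof.
rewrite (_ : radius = Num.sqrt \o (fun t => \sum_i tnth t i ^+ 2)); last first.
  by apply/funext => t; rewrite radiusE.
apply: measurableT_comp.
  by apply: continuous_measurable_fun; exact: sqrt_continuous.
apply: measurable_sum => i; apply: measurable_funX; exact: measurable_tnth.
Qed.

Definition shell (a b : R) : set T := [set t | a < radius t < b].

Lemma measurable_shell a b : measurable (shell a b).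
Proof.
rewrite (_ : shell a b = radius @^-1` `]a, b[).
  by apply: measurable_preimage measurable_radius _.
by apply/seteqP; split => t; rewrite /preimage/= in_itv.
Qed.

Lemma shell_finite a b : (mu (shell a b) < +oo)%E.
Proof.
apply: (@le_lt_trans _ _ (mu [set t : T | forall i : 'I_N, (`[- b, b]%classic : set RT) (tnth t i)])).
  apply: le_measure; rewrite ?inE//; first exact: measurable_shell.
    exact: (@measurable_box _ _ (fun=> `[- b, b]%classic)).
  move=> t /andP[_ tb] i /=; rewrite in_itv/= -ler_norml.
  by have := coord_le_enorm (rV_of_tuple t) i; rewrite mxE => /le_trans; apply; exact: ltW.
rewrite (@lebesgue_tuple_box _ _ (fun=> `[- b, b]%classic))//.
elim: (index_enum _) => [|i s IH]; first by rewrite big_nil ltry.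
rewrite big_cons lte_mul_pinfty// lebesgue_measure_itv/=.
by case: ifP => _; rewrite -?EFinD.
Qed.

End shell.

Section moments.
Variables (R : realType) (N : nat).
Local Notation RT := (measurableTypeR R).
Local Notation T := (N.-tuple RT).
Local Notation mu := (lebesgue_tuple R N).

Definition shear (i j : 'I_N) (a : R) : T -> T :=
  shift_coord i (fun t => a * tnth t j).

Lemma measurable_shear i j a : measurable_fun [set: T] (shear i j a).
Proof.
apply: measurable_shift_coord; apply: measurable_funM => //.
exact: measurable_tnthT.
Qed.

Lemma lebesgue_tuple_shear i j a (A : set T) : i != j -> measurable A ->
  mu (shear i j a @^-1` A) = mu A.
Proof.
move=> ij mA; apply: lebesgue_tuple_shift_coord => //.
  by apply: measurable_funM => //; exact: measurable_tnthT.
by move=> t t' tt'; rewrite tt'// eq_sym.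
Qed.

(* Three shears make up the rotation of the (i, j) plane by the angle whose
   half has tangent - a, provided that b = - 2 a / (1 + a ^ 2). *)
Definition plane_rotation i j a b (t : T) : T :=
  shear i j a (shear j i b (shear i j a t)).

Lemma measurable_plane_rotation i j a b :
  measurable_fun [set: T] (plane_rotation i j a b).
Proof.
apply: (measurableT_comp (measurable_shear i j a)).
apply: (measurableT_comp (measurable_shear j i b)).
exact: measurable_shear.
Qed.

Lemma lebesgue_tuple_plane_rotation i j a b (A : set T) :
  i != j -> measurable A -> mu (plane_rotation i j a b @^-1` A) = mu A.
Proof.
move=> ij mA; have ji : j != i by rewrite eq_sym.
have m1 := measurable_preimage (measurable_shear i j a) mA.
have m2 := measurable_preimage (measurable_shear j i b) m1.
rewrite -(lebesgue_tuple_shear a ij mA) -(lebesgue_tuple_shear b ji m1).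
by rewrite -[RHS](lebesgue_tuple_shear a ij m2).
Qed.

Lemma plane_rotationE i j a b t : i != j -> a ^+ 2 * b + 2 * a + b = 0 ->
  [/\ tnth (plane_rotation i j a b t) i = (1 + a * b) * tnth t i - b * tnth t j,
      tnth (plane_rotation i j a b t) j = b * tnth t i + (1 + a * b) * tnth t j &
      forall k, k != i -> k != j -> tnth (plane_rotation i j a b t) k = tnth t k].
Proof.
move=> ij ab; have ji : (j == i) = false by rewrite eq_sym; exact: negbTE.
split.
- rewrite !tnth_mktuple !eqxx ji (negbTE ij).
  apply/eqP; rewrite -subr_eq0; apply/eqP.
  transitivity ((a ^+ 2 * b + 2 * a + b) * tnth t j); first by ring.
  by rewrite ab mul0r.
- by rewrite !tnth_mktuple !eqxx ji; ring.
- by move=> k /negbTE ki /negbTE kj; rewrite !tnth_mktuple ki kj.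
Qed.

Lemma radius_plane_rotation i j a b t : i != j ->
  a ^+ 2 * b + 2 * a + b = 0 -> radius (plane_rotation i j a b t) = radius t.
Proof.
move=> ij ab; have [ti tj tk] := plane_rotationE t ij ab.
rewrite !radiusE; congr Num.sqrt.
rewrite (bigD1 i)//= [RHS](bigD1 i)//= (bigD1 j) 1?eq_sym//= [in RHS](bigD1 j) 1?eq_sym//=.
rewrite !addrA; congr (_ + _); last first.
  by apply: eq_bigr => k /andP[ki kj]; rewrite tk.
have E : (1 + a * b) ^+ 2 + b ^+ 2 = 1.
  have -> : (1 + a * b) ^+ 2 + b ^+ 2 = 1 + b * (a ^+ 2 * b + 2 * a + b) by ring.
  by rewrite ab mulr0 addr0.
rewrite ti tj.
transitivity (((1 + a * b) ^+ 2 + b ^+ 2) * (tnth t i ^+ 2 + tnth t j ^+ 2)); first by ring.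
by rewrite E mul1r.
Qed.

Variables R0 R1 : R.
Local Notation D := (@shell R N R0 R1).

Lemma Rintegral_plane_rotation i j a b (F : T -> R) : i != j ->
  a ^+ 2 * b + 2 * a + b = 0 ->
  measurable_fun D F -> (forall t, 0 <= F t) ->
  \int[mu]_(t in D) F t = \int[mu]_(t in D) F (plane_rotation i j a b t).
Proof.
move=> ij ab mF F0.
rewrite (@ge0_Rintegral_scaling _ _ _ mu (plane_rotation i j a b) 1)//.
- rewrite mul1r (_ : _ @^-1` _ = D)//.
  by apply/seteqP; split => t; rewrite /shell/= radius_plane_rotation.
- exact: measurable_plane_rotation.
- by move=> A mA; rewrite mul1e; apply/esym/lebesgue_tuple_plane_rotation.
- exact: measurable_shell.
Qed.

Lemma bounded_measurable_coord i :
  bounded_measurable D (fun t : T => tnth t i : R).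
Proof.
split; first by apply: measurable_funTS; exact: measurable_tnthT.
exists R1 => t /andP[_ tb].
by have := coord_le_enorm (rV_of_tuple t) i; rewrite mxE => /le_trans; apply; exact: ltW.
Qed.

Lemma bounded_measurable_radius : bounded_measurable D (@radius R N).
Proof.
split; first by apply: measurable_funTS; exact: measurable_radius.
by exists R1 => t /andP[_ tb]; rewrite ger0_norm ?enorm_ge0// ltW.
Qed.

Variable f : R -> R.
Hypotheses (f0 : forall r, 0 <= f r).
Let w (t : T) := f (radius t).
Hypothesis bw : bounded_measurable D w.
Let bx i := bounded_measurable_coord i.
Let br := bounded_measurable_radius.
Let mD := @measurable_shell R N R0 R1.
Let finD := @shell_finite R N R0 R1.
Let w_rot i j a b t : i != j -> a ^+ 2 * b + 2 * a + b = 0 ->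
  w (plane_rotation i j a b t) = w t.
Proof. by move=> ij ab; rewrite /w radius_plane_rotation. Qed.

Let J F := \int[mu]_(t in D) F t.

Lemma second_moment_sym i j :
  J (fun t => w t * tnth t i ^+ 2) = J (fun t => w t * tnth t j ^+ 2).
Proof.
have [->//|ij] := eqVneq i j.
(* These parameters give the quarter turn, under which coordinate [i] becomes minus coordinate
   [j]. *)
have E : (-1 : R) ^+ 2 * 1 + 2 * -1 + 1 = 0 by ring.
rewrite /J (Rintegral_plane_rotation ij E).
- apply: eq_Rintegral => t _.
  have [-> _ _] := plane_rotationE t ij E.
  by rewrite w_rot//; ring.
- by case: (bounded_measurableM bw (bounded_measurableX 2 (bx i))).
- by move=> t; rewrite mulr_ge0 ?f0 ?sqr_ge0.
Qed.

Lemma second_moment i :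
  N%:R * J (fun t => w t * tnth t i ^+ 2) = J (fun t => w t * radius t ^+ 2).
Proof.
transitivity (J (fun t => \sum_j w t * tnth t j ^+ 2)).
  rewrite /J Rintegral_sum_bounded//; last first.
    by move=> j; apply: bounded_measurableM => //; exact: bounded_measurableX.
  rewrite (eq_bigr (fun=> J (fun t => w t * tnth t i ^+ 2))).
    by rewrite sumr_const card_ord mulr_natl.
  by move=> j _; exact: second_moment_sym.
by apply: eq_Rintegral => t _; rewrite radius_sqr mulr_sumr.
Qed.

Lemma fourth_moment_sym i j :
  J (fun t => w t * tnth t i ^+ 4) = J (fun t => w t * tnth t j ^+ 4).
Proof.
have [->//|ij] := eqVneq i j.
have E : (-1 : R) ^+ 2 * 1 + 2 * -1 + 1 = 0 by ring.
rewrite /J (Rintegral_plane_rotation ij E).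
- apply: eq_Rintegral => t _.
  have [-> _ _] := plane_rotationE t ij E.
  by rewrite w_rot//; ring.
- by case: (bounded_measurableM bw (bounded_measurableX 4 (bx i))).
- by move=> t; rewrite mulr_ge0 ?f0 ?exprn_even_ge0.
Qed.

(** Invariance under the rotations of cosine 3/5 and sine 4/5 or -4/5, whose coefficients are
    rational. Adding the two expansions of the fourth power cancels the odd terms and leaves 2 X =
    (162 X + 1728 Z + 512 X) / 625, that is X = 3 Z. *)
Lemma fourth_moment_mixed i j : i != j ->
  J (fun t => w t * tnth t i ^+ 4) =
  3 * J (fun t => w t * (tnth t i ^+ 2 * tnth t j ^+ 2)).
Proof.
move=> ij; set X := LHS; set Z := J _.
have rot s : s ^+ 2 = 1 -> X =
    J (fun t => w t * (3 / 5 * tnth t i - s * (4 / 5) * tnth t j) ^+ 4).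
  move=> s2; have E : (- s / 2) ^+ 2 * (s * (4 / 5)) + 2 * (- s / 2) + s * (4 / 5) = 0.
    have -> : (- s / 2) ^+ 2 * (s * (4 / 5)) + 2 * (- s / 2) + s * (4 / 5) =
      s / 5 * (s ^+ 2 - 1) by field.
    by rewrite s2 subrr mulr0.
  rewrite /X /J (Rintegral_plane_rotation ij E).
  - apply: eq_Rintegral => t _.
    have [-> _ _] := plane_rotationE t ij E; rewrite w_rot//.
    have -> : 1 + - s / 2 * (s * (4 / 5)) = 3 / 5 + 2 / 5 * (1 - s ^+ 2) by field.
    by rewrite s2 subrr mulr0 addr0.
  - by case: (bounded_measurableM bw (bounded_measurableX 4 (bx i))).
  - by move=> t; rewrite mulr_ge0 ?f0 ?exprn_even_ge0.
have b4 k : bounded_measurable D (fun t => w t * tnth t k ^+ 4).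
  by apply: bounded_measurableM => //; exact: bounded_measurableX.
have b22 : bounded_measurable D (fun t => w t * (tnth t i ^+ 2 * tnth t j ^+ 2)).
  by apply: bounded_measurableM => //; apply: bounded_measurableM; exact: bounded_measurableX.
have brot s : bounded_measurable D
    (fun t => w t * (3 / 5 * tnth t i - s * (4 / 5) * tnth t j) ^+ 4).
  apply: bounded_measurableM => //; apply: bounded_measurableX.
  under [X in bounded_measurable _ X]eq_fun do rewrite -mulNr.
  by apply: bounded_measurableD; apply: bounded_measurableZ.
pose P s := J (fun t => w t * (3 / 5 * tnth t i - s * (4 / 5) * tnth t j) ^+ 4).
have P1 : X = P 1 by apply: rot; rewrite expr1n.
have PN1 : X = P (-1) by apply: rot; rewrite sqrrN expr1n.
pose X' := J (fun t => w t * tnth t j ^+ 4).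
have XX' : X' = X by exact: fourth_moment_sym.
have : P 1 + P (-1) = 162 / 625 * X + (1728 / 625 * Z + 512 / 625 * X').
  rewrite /P /X /Z /X' /J -!RintegralZ_bounded//.
  have b1 := bounded_measurableZ (162 / 625) (b4 i).
  have b2 := bounded_measurableZ (1728 / 625) b22.
  have b3 := bounded_measurableZ (512 / 625) (b4 j).
  rewrite -(RintegralD_bounded mD finD b2 b3).
  rewrite -(RintegralD_bounded mD finD b1 (bounded_measurableD b2 b3)).
  rewrite -(RintegralD_bounded mD finD (brot 1) (brot (-1))).
  by apply: eq_Rintegral => t _; field.
by rewrite -P1 -PN1 XX'; lra.
Qed.

End moments.

Section axial_moments.
Variables (R : realType) (N : nat) (R0 R1 : R) (f : R -> R).
Local Notation RT := (measurableTypeR R).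
Local Notation T := (N.-tuple RT).
Local Notation mu := (lebesgue_tuple R N).
Local Notation D := (@shell R N R0 R1).
Hypotheses (R0_gt0 : 0 < R0) (f0 : forall r, 0 <= f r).
Hypothesis bf : bounded_measurable D (fun t => f (radius t)).
Let mD := @measurable_shell R N R0 R1.
Let finD := @shell_finite R N R0 R1.
Let bx i := @bounded_measurable_coord R N R0 R1 i.
Let br := @bounded_measurable_radius R N R0 R1.

(** In the second moment of weight f(r) r^2, expand r^2 as the sum of the x_j^2: the term j = i is
    the fourth moment X, and each of the N - 1 others is X / 3. The total is (N + 2) X / 3. *)
Lemma fourth_moment i :
  N%:R * (N%:R + 2) * (\int[mu]_(t in D) (f (radius t) * tnth t i ^+ 4)) =
  3 * \int[mu]_(t in D) (f (radius t) * radius t ^+ 4).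
Proof.
set X := \int[mu]_(t in D) (f (radius t) * tnth t i ^+ 4).
have bf2 : bounded_measurable D (fun t => f (radius t) * radius t ^+ 2).
  by apply: bounded_measurableM => //; exact: bounded_measurableX.
have f20 r : 0 <= f r * r ^+ 2 by rewrite mulr_ge0 ?sqr_ge0.
have := second_moment (f := fun r => f r * r ^+ 2) f20 bf2 i => /=.
under [RHS]eq_Rintegral do rewrite -mulrA -exprD.
move=> <-; rewrite -mulrA [3 * _]mulrCA; congr (_ * _).
have -> : \int[mu]_(t in D) (f (radius t) * radius t ^+ 2 * tnth t i ^+ 2) =
    X + \sum_(j < N | j != i) X / 3.
  transitivity (\int[mu]_(t in D)
      \sum_(j < N) f (radius t) * (tnth t i ^+ 2 * tnth t j ^+ 2)).
    apply: eq_Rintegral => t _; rewrite radius_sqr -mulr_sumr -mulrA; congr (_ * _).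
    by rewrite mulrC mulr_sumr.
  rewrite Rintegral_sum_bounded//; last first.
    move=> j; apply: bounded_measurableM => //.
    by apply: bounded_measurableM; exact: bounded_measurableX.
  rewrite (bigD1 i)//=; congr (_ + _).
    by apply: eq_Rintegral => t _; rewrite -exprD.
  apply: eq_bigr => j ji; rewrite /X (fourth_moment_mixed (j := j) f0 bf) 1?eq_sym//.
  by field.
have -> : \sum_(j < N | j != i) X / 3 = (N%:R - 1) * (X / 3).
  set z := X / 3; have := sumr_const 'I_N z.
  rewrite (bigD1 i)//= card_ord => E.
  by rewrite mulrBl mul1r mulr_natl -E addrAC subrr add0r.
by field.
Qed.

Lemma bounded_measurable_radiusV k :
  bounded_measurable D (fun t => (radius t ^+ k)^-1).
Proof.
split.
  apply: (eq_measurable_fun (fun t => (radius t ^+ k) `^ (-1))).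
    by move=> t _; rewrite powR_inv1// exprn_ge0// enorm_ge0.
  apply: measurable_funTS.
  apply: (@measurableT_comp _ _ _ _ _ _ (@powR R ^~ (-1)) _ (fun t => radius t ^+ k)).
    exact: measurable_powR.
  by apply: measurable_funX; exact: measurable_radius.
exists ((R0 ^+ k)^-1) => t /andP[t0 _].
have r0 := lt_trans R0_gt0 t0.
rewrite ger0_norm ?invr_ge0 ?exprn_ge0 ?(ltW r0)//.
by rewrite lef_pV2 ?posrE ?exprn_gt0// lerXn2r ?nnegrE ?ltW.
Qed.

(** The squared sine of the angle between x and the hyperplane x_i = 0. *)
Definition axial_ratio i (t : T) : R := tnth t i ^+ 2 / radius t ^+ 2.

Lemma bounded_measurable_axial_ratio i : bounded_measurable D (axial_ratio i).
Proof.
by apply: bounded_measurableM; [exact: bounded_measurableX|exact: bounded_measurable_radiusV].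
Qed.

End axial_moments.

Section axial_moments_ratio.
Variables (R : realType) (N : nat) (R0 R1 : R) (f : R -> R).
Local Notation RT := (measurableTypeR R).
Local Notation T := (N.-tuple RT).
Local Notation mu := (lebesgue_tuple R N).
Local Notation D := (@shell R N R0 R1).
Hypotheses (R0_gt0 : 0 < R0) (f0 : forall r, 0 <= f r).
Hypothesis bf : bounded_measurable D (fun t => f (radius t)).

Lemma Rintegral_axial_ratio i :
  N%:R * (\int[mu]_(t in D) (f (radius t) * axial_ratio i t)) =
  \int[mu]_(t in D) f (radius t).
Proof.
have h0 r : 0 <= f r * (r ^+ 2)^-1 by rewrite mulr_ge0 ?invr_ge0 ?sqr_ge0.
have bh : bounded_measurable D (fun t => f (radius t) * (radius t ^+ 2)^-1).
  by apply: bounded_measurableM => //; exact: bounded_measurable_radiusV.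
have := second_moment (f := fun r => f r * (r ^+ 2)^-1) h0 bh i => /=.
rewrite (@eq_Rintegral _ _ _ mu D (fun t => f (radius t) * axial_ratio i t)); last first.
  by move=> t _; rewrite /axial_ratio mulrAC mulrA.
rewrite [X in _ = X -> _](@eq_Rintegral _ _ _ mu D (fun t => f (radius t))); last first.
  move=> t; rewrite inE => /andP[t0 _].
  by rewrite divfK// expf_neq0// gt_eqF// (lt_trans R0_gt0).
by [].
Qed.

Lemma Rintegral_axial_ratio_sqr i :
  N%:R * (N%:R + 2) * (\int[mu]_(t in D) (f (radius t) * axial_ratio i t ^+ 2)) =
  3 * \int[mu]_(t in D) f (radius t).
Proof.
have h0 r : 0 <= f r * (r ^+ 4)^-1 by rewrite mulr_ge0 ?invr_ge0 ?exprn_even_ge0.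
have bh : bounded_measurable D (fun t => f (radius t) * (radius t ^+ 4)^-1).
  by apply: bounded_measurableM => //; exact: bounded_measurable_radiusV.
have := fourth_moment (f := fun r => f r * (r ^+ 4)^-1) h0 bh i => /=.
rewrite (@eq_Rintegral _ _ _ mu D (fun t => f (radius t) * axial_ratio i t ^+ 2)); last first.
  by move=> t _; rewrite /axial_ratio -mulrA [_^-1 * _]mulrC exprMn exprVn -!exprM.
rewrite [X in _ = _ * X -> _](@eq_Rintegral _ _ _ mu D (fun t => f (radius t))); last first.
  move=> t; rewrite inE => /andP[t0 _].
  by rewrite divfK// expf_neq0// gt_eqF// (lt_trans R0_gt0).
by [].
Qed.

End axial_moments_ratio.

(** * Hardy's inequality *)

(** This glues the extension by zero of a squared profile at the endpoints of the interval, where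
    the profile vanishes. *)
Lemma is_derive_quadratic (R : realType) (F : R -> R) (a C : R) :
  (forall x, `|F x| <= C * (x - a) ^+ 2) -> is_derive a 1 F 0.
Proof.
move=> FC; have Fa : F a = 0.
  by apply/eqP; rewrite -normr_le0 (le_trans (FC a))// subrr expr0n mulr0.
suff h0 : h^-1 *: ((F \o shift a) (h *: 1) - F a) @[h --> 0^'] --> (0 : R).
  by apply: DeriveDef; [exact/cvgP/h0|exact/cvg_lim].
apply/cvgr0Pnorm_le => e e0; near=> h.
have h_neq0 : h != 0 by near: h; exact: nbhs_dnbhs_neq.
rewrite /= Fa subr0 scaler1 normrM normfV ler_pdivrMl ?normr_gt0//.
rewrite (le_trans (FC _))// addrK -[h ^+ 2]real_normK ?num_real// expr2 mulrCA ler_pM2l ?normr_gt0//.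
have : `|h| < e / (`|C| + 1).
  near: h; apply: dnbhs0_lt; rewrite divr_gt0// ltr_wpDl//.
rewrite ltr_pdivlMr ?ltr_wpDl// => /ltW; apply: le_trans.
by rewrite mulrC ler_wpM2l// (le_trans (ler_norm _))// lerDl.
Unshelve. all: by end_near. Qed.

Section weighted_square.
Variables (R : realType) (R0 R1 M : R) (g g' : R -> R).
Hypotheses (R0_gt0 : 0 < R0) (R01 : R0 < R1).
Hypothesis cg : {within `[R0, R1], continuous g}.
Hypothesis dg : forall r, r \in `]R0, R1[ -> is_derive r 1 g (g' r).
Hypotheses (gR0 : g R0 = 0) (gR1 : g R1 = 0).
Hypothesis g'M : forall r, r \in `]R0, R1[ -> `|g' r| <= M.

Lemma weighted_square_lip a b : R0 <= a -> a <= b -> b <= R1 ->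
  `|g b - g a| <= M * (b - a).
Proof.
move=> R0a; rewrite le_eqVlt => /predU1P[->|ab] bR1.
  by rewrite !subrr normr0 mulr0.
have sub : `[a, b] `<=` `[R0, R1] by apply: subset_itv; rewrite bnd_simp.
have subo r : r \in `]a, b[ -> r \in `]R0, R1[.
  by rewrite !in_itv/= => /andP[ar rb]; rewrite (le_lt_trans R0a ar) (lt_le_trans rb bR1).
have [c cab ->] := @MVT _ g g' a b ab (fun r hr => dg (subo r hr)) (continuous_subspaceW sub cg).
by rewrite normrM (gtr0_norm (x := b - a)) ?subr_gt0// ler_wpM2r ?subr_ge0 ?(ltW ab)// g'M// subo.
Qed.

Lemma deriv_bound_ge0 : 0 <= M.
Proof.
have mid : (R0 + R1) / 2 \in `]R0, R1[ by rewrite in_itv/=; move: (R01) => h; apply/andP; split; lra.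
exact: le_trans (normr_ge0 _) (g'M mid).
Qed.

Lemma profile_bound r : R0 <= r <= R1 -> `|g r| <= M * (R1 - R0).
Proof.
move=> /andP[R0r rR1]; have := weighted_square_lip (lexx _) R0r rR1.
rewrite gR0 subr0 => /le_trans; apply; apply: ler_wpM2l; first exact: deriv_bound_ge0.
by rewrite lerD2r.
Qed.

(** The factor F of the field x F behind Hardy's inequality. The extension by zero makes it a
    function on the whole line, so that its dilates can be integrated over a domain that does not
    move. *)
Definition weighted_square r := if r \in `]R0, R1[ then g r ^+ 2 / r ^+ 2 else 0.

Definition weighted_square' r := if r \in `]R0, R1[
  then 2 * g r * g' r / r ^+ 2 - 2 * g r ^+ 2 / r ^+ 3 else 0.

(** The only delicate points are [R0] and [R1]: there g vanishes and is Lipschitz with constant [M],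
    so its square is quadratically small and both one-sided derivatives are 0. The derivative need
    not be continuous, since differentiation under the integral only asks that it be bounded. *)
Lemma is_derive_weighted_square (r : R) :
  is_derive r (1 : R) weighted_square (weighted_square' r).
Proof.
have quad (a : R) : (forall x, x \in `]R0, R1[ -> `|g x| <= M * `|x - a|) ->
    a \notin `]R0, R1[ -> is_derive a (1 : R) weighted_square (weighted_square' a).
  move=> ga aN; rewrite /weighted_square' (negbTE aN).
  apply: (@is_derive_quadratic _ _ _ (M ^+ 2 / R0 ^+ 2)) => x.
  rewrite /weighted_square; case: ifPn => [xin|_]; last first.
    by rewrite normr0 mulr_ge0 ?sqr_ge0// divr_ge0 ?sqr_ge0.
  have x0 : R0 < x by move: xin; rewrite in_itv/= => /andP[].
  rewrite normrM normfV !normrX [X in _ <= X]mulrAC; apply: ler_pM.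
  - by rewrite exprn_ge0.
  - by rewrite invr_ge0 exprn_ge0.
  - rewrite -[(x - a) ^+ 2]real_normK ?num_real// -exprMn lerXn2r ?nnegrE//.
      by rewrite mulr_ge0 ?deriv_bound_ge0.
    exact: ga.
  - have x_gt0 := lt_trans R0_gt0 x0.
    rewrite lef_pV2 ?posrE ?exprn_gt0 ?normr_gt0 ?(gt_eqF x_gt0)//.
    by rewrite (ger0_norm (ltW x_gt0)) lerXn2r ?nnegrE ?ltW.
have [rin|rout] := boolP (r \in `]R0, R1[).
  rewrite /weighted_square' rin.
  have r0 : r != 0 by move: rin; rewrite in_itv/= => /andP[R0r _]; rewrite gt_eqF// (lt_trans R0_gt0).
  apply: (@near_eq_is_derive _ _ _ (fun x => g x ^+ 2 / x ^+ 2)).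
  - near=> x; rewrite /weighted_square ifT//; near: x.
    exact: near_in_itvoo.
  have dgr := dg rin.
  have r20 : r ^+ 2 != 0 by rewrite expf_neq0.
  apply: is_derive_eq.
  rewrite /GRing.scale/=.
  by field.
have [->|rR0] := eqVneq r R0.
  apply: quad; last by rewrite in_itv/= ltxx.
  move=> x; rewrite in_itv/= => /andP[x0 x1].
  have -> : `|x - R0| = x - R0 by rewrite ger0_norm// subr_ge0 ltW.
  by have := weighted_square_lip (lexx _) (ltW x0) (ltW x1); rewrite gR0 subr0.
have [->|rR1] := eqVneq r R1.
  apply: quad; last by rewrite in_itv/= ltxx andbF.
  move=> x; rewrite in_itv/= => /andP[x0 x1].
  have -> : `|x - R1| = R1 - x by rewrite distrC ger0_norm// subr_ge0 ltW.
  by have := weighted_square_lip (ltW x0) (ltW x1) (lexx _); rewrite gR1 sub0r normrN.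
rewrite /weighted_square' (negbTE rout).
apply: (@near_eq_is_derive _ _ _ (cst 0)).
- have : r < R0 \/ R1 < r.
    move: rout; rewrite in_itv/= negb_and -!leNgt.
    by move=> /orP[h|h]; [left; rewrite lt_neqAle rR0|right; rewrite lt_neqAle eq_sym rR1].
  move=> [rlt|rgt]; near=> x; rewrite /weighted_square ifF// in_itv/=; apply/negbTE; rewrite negb_and -!leNgt.
    by apply/orP; left; near: x; apply: filterS (lt_nbhsl rlt) => y /ltW.
  by apply/orP; right; near: x; apply: filterS (lt_nbhsr rgt) => y /ltW.
Unshelve. all: by end_near. Qed.

End weighted_square.

Section hardy.
Variables (R : realType) (N : nat) (R0 R1 M : R) (g g' : R -> R).
Local Notation T := (N.-tuple (measurableTypeR R)).
Local Notation mu := (lebesgue_tuple R N).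
Local Notation D := (@shell R N R0 R1).
Local Notation B := (@shell R N (R0 / 2) (2 * R1)).
Hypotheses (R0_gt0 : 0 < R0) (R01 : R0 < R1).
Hypothesis cg : {within `[R0, R1], continuous g}.
Hypothesis dg : forall r, r \in `]R0, R1[ -> is_derive r 1 g (g' r).
Hypotheses (gR0 : g R0 = 0) (gR1 : g R1 = 0).
Hypothesis g'M : forall r, r \in `]R0, R1[ -> `|g' r| <= M.
Hypothesis bg : bounded_measurable D (fun t => g (radius t)).
Hypothesis bg' : bounded_measurable D (fun t => g' (radius t)).
Let mD := @measurable_shell R N R0 R1.
Let finD := @shell_finite R N R0 R1.
Let mB := @measurable_shell R N (R0 / 2) (2 * R1).
Let finB := @shell_finite R N (R0 / 2) (2 * R1).
Let R1_gt0 : 0 < R1 := lt_trans R0_gt0 R01.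

Local Notation G := (weighted_square R0 R1 g).
Local Notation G' := (weighted_square' R0 R1 g g').

Let dG (r : R) : is_derive r (1 : R) G (G' r).
Proof. exact: (is_derive_weighted_square R0_gt0 R01 cg dg gR0 gR1 g'M). Qed.

Lemma weighted_square_ge0 r : 0 <= G r.
Proof. by rewrite /weighted_square; case: ifP => // _; rewrite divr_ge0 ?sqr_ge0. Qed.

Let M_ge0 : 0 <= M := deriv_bound_ge0 R01 g'M.

Let g_bound r : r \in `]R0, R1[ -> `|g r| <= M * (R1 - R0).
Proof.
rewrite in_itv/= => /andP[a b].
by apply: (profile_bound R01 cg dg gR0 g'M); rewrite !ltW.
Qed.

Let rV_bound r k : r \in `]R0, R1[ -> `|r ^+ k|^-1 <= (R0 ^+ k)^-1.
Proof.
rewrite in_itv/= => /andP[R0r rR1]; have r0 := lt_trans R0_gt0 R0r.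
rewrite ger0_norm ?exprn_ge0 ?(ltW r0)// lef_pV2 ?posrE ?exprn_gt0//.
by rewrite lerXn2r ?nnegrE ?ltW.
Qed.

Lemma weighted_square_bounded : exists C : R, forall r, `|G r| <= C.
Proof.
exists ((M * (R1 - R0)) ^+ 2 / R0 ^+ 2) => r; rewrite /weighted_square.
have C0 : 0 <= M * (R1 - R0) by rewrite mulr_ge0// subr_ge0 ltW.
case: ifPn => [rin|_]; last by rewrite normr0 divr_ge0 ?sqr_ge0.
rewrite normrM normrX normfV ler_pM ?invr_ge0 ?exprn_ge0 ?normr_ge0 ?rV_bound//.
by rewrite lerXn2r ?nnegrE// g_bound.
Qed.

Lemma weighted_square'_bounded : exists2 C : R, 0 <= C & forall r, `|G' r| <= C.
Proof.
have C0 : 0 <= M * (R1 - R0) by rewrite mulr_ge0// subr_ge0 ltW.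
pose C := M * (R1 - R0).
have A0 : 0 <= 2 * C * M / R0 ^+ 2 + 2 * C ^+ 2 / R0 ^+ 3.
  have C_ge0 : 0 <= C by [].
  have R0_ge0 := ltW R0_gt0.
  by rewrite addr_ge0// divr_ge0 ?exprn_ge0// mulr_ge0 ?exprn_ge0// mulr_ge0.
exists (2 * C * M / R0 ^+ 2 + 2 * C ^+ 2 / R0 ^+ 3) => // r.
rewrite /weighted_square'; case: ifPn => [rin|_]; last by rewrite normr0.
rewrite (le_trans (ler_normB _ _))//; apply: lerD.
  rewrite !normrM normfV (ger0_norm (ler0n _ 2)).
  apply: ler_pM; rewrite ?mulr_ge0 ?invr_ge0 ?rV_bound//.
  by apply: ler_pM; rewrite ?mulr_ge0 ?g'M// ler_pM2l// g_bound.
rewrite normrM normfV (normrM 2) (ger0_norm (ler0n _ 2)).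
apply: ler_pM; rewrite ?mulr_ge0 ?invr_ge0 ?rV_bound// ler_pM2l//.
by rewrite normrX lerXn2r ?nnegrE// g_bound.
Qed.

Let measurable_G : measurable_fun [set: R] G.
Proof.
apply: continuous_measurable_fun => r; apply: differentiable_continuous.
by apply/derivable1_diffP; have [] := dG r.
Qed.

Let f (l : R) (t : T) := G (l * radius t).

Let measurable_f l : measurable_fun [set: T] (f l).
Proof.
apply: (measurableT_comp measurable_G).
by apply: measurable_funM => //; exact: measurable_radius.
Qed.

Let f_integrable l : mu.-integrable B (EFin \o f l).
Proof.
apply: bounded_measurable_integrable => //; split; first exact: measurable_funTS.
by have [C GC] := weighted_square_bounded; exists C => t _; exact: GC.
Qed.

Let df l t : is_derive l (1 : R) (f ^~ t) (radius t * G' (l * radius t)).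
Proof.
have h : is_derive l (1 : R) (fun x : R => x * radius t) (radius t).
  by apply: is_derive_eq; rewrite /GRing.scale/= mulr1 mulr0 add0r.
by have := @is_derive1_comp _ G (fun x : R => x * radius t) l _ _ (dG (l * radius t)) h; rewrite mulrC.
Qed.

Let I := fun l : R => \int[mu]_(t in B) f l t.

(** For 1/2 < l < 2 the support R0 / l < |x| < R1 / l stays inside the enlarged shell. The integral
    can thus be read over the whole space, where dilations act, or over a fixed set of finite
    measure, where a constant dominates the derivatives. *)
Let I_setT l : 1 / 2 < l < 2 -> I l = \int[mu]_t f l t.
Proof.
move=> /andP[l2 l3]; rewrite /I Rintegral_mkcond; apply: eq_Rintegral => t _.
rewrite patchE; case: ifPn => //; rewrite notin_setE /shell/= => h.
rewrite /f /weighted_square ifF// in_itv/=; apply/negP => /andP[a b]; apply: h.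
have l0 : 0 < l by lra.
have r0 : 0 <= radius t := enorm_ge0 _.
by apply/andP; split; nra.
Qed.

Let I_scale l : 1 / 2 < l < 2 -> l ^+ N * I l = I 1.
Proof.
move=> l2; have l0 : 0 < l by lra.
rewrite !I_setT//; last by apply/andP; split; lra.
apply/esym; rewrite (@ge0_Rintegral_scaling _ _ _ mu (@scale_tuple R N l) (l ^+ N))//.
- rewrite preimage_setT; congr (_ * _); apply: eq_Rintegral => t _.
  by rewrite /f mul1r radius_scale_tuple// ltW.
- exact: measurable_scale_tuple.
- exact: exprn_gt0.
- by move=> A mA; exact: lebesgue_tuple_scale.
- by move=> t _; exact: weighted_square_ge0.
Qed.

Let d1f : partial1of2 f = fun l t => radius t * G' (l * radius t).
Proof.
by apply/funext => l; apply/funext => t; rewrite partial1of2E; case: (df l t).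
Qed.

Let derivable_I : derivable I 1 1 /\
  derive1 I 1 = \int[mu]_(t in B) (radius t * G' (radius t)).
Proof.
have [C C0 GC] := weighted_square'_bounded.
pose H (t : T) : R := 2 * R1 * C.
have H0 t : 0 <= H t by rewrite !mulr_ge0// ltW.
have intH : mu.-integrable B (EFin \o H).
  by apply: bounded_measurable_integrable => //; exact: bounded_measurable_cst.
have one : [set` `](1 / 2 : R), 2[] 1 by rewrite /= in_itv/=; apply/andP; split; lra.
have der l t : [set` `](1 / 2 : R), 2[] l -> B t -> derivable (f ^~ t) l 1.
  by move=> _ _; case: (df l t).
have ub l t : [set` `](1 / 2 : R), 2[] l -> B t -> `|partial1of2 f l t| <= H t.
  move=> _ /andP[_ tR1]; rewrite d1f normrM ler_pM ?GC//.
  by rewrite ger0_norm ?enorm_ge0// ltW.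
have intf l : [set` `](1 / 2 : R), 2[] l -> mu.-integrable B (EFin \o f l).
  by move=> _; exact: f_integrable.
split; first exact: (derivable_under_integral mB one intf der H0 intH ub).
rewrite (differentiation_under_integral mB one intf der H0 intH ub).
rewrite -[LHS]/(\int[mu]_(y in B) (partial1of2 f 1 y)) d1f.
by apply: eq_Rintegral => t _; rewrite mul1r.
Qed.

Let shell_sub : D `<=` B.
Proof.
move=> t /andP[a b]; apply/andP.
have h0 := R0_gt0; have h1 := R1_gt0.
by split; lra.
Qed.

Let Rintegral_patch (h : R -> R) : (forall r, r \notin `]R0, R1[ -> h r = 0) ->
  \int[mu]_(t in B) h (radius t) = \int[mu]_(t in D) h (radius t).
Proof.
move=> h0; rewrite Rintegral_mkcond [RHS]Rintegral_mkcond; congr (Rintegral _ _ _).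
apply/funext => t; rewrite !patchE.
case: ifPn => tB; case: ifPn => tD //.
  by apply: h0; move: tD; rewrite notin_setE /shell/= in_itv/= => /negP.
by move: tD; rewrite inE => /shell_sub; move: tB; rewrite notin_setE.
Qed.

(* The derivative at l = 1 of l |-> l ^+ N * \int G (l |x|) dx, which is constant. *)
Lemma shell_divergence :
  N%:R * \int[mu]_(t in D) (g (radius t) ^+ 2 / radius t ^+ 2) +
  \int[mu]_(t in D) (radius t * (2 * g (radius t) * g' (radius t) / radius t ^+ 2
     - 2 * g (radius t) ^+ 2 / radius t ^+ 3)) = 0.
Proof.
have [dI I'] := derivable_I.
have E1 : I 1 = \int[mu]_(t in D) (g (radius t) ^+ 2 / radius t ^+ 2).
  rewrite /I /f; under eq_Rintegral do rewrite mul1r.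
  rewrite Rintegral_patch; last by move=> r rN; rewrite /weighted_square (negbTE rN).
  by apply: eq_Rintegral => t; rewrite inE /shell/= => tD; rewrite /weighted_square in_itv/= tD.
have E2 : derive1 I 1 = \int[mu]_(t in D) (radius t *
    (2 * g (radius t) * g' (radius t) / radius t ^+ 2
     - 2 * g (radius t) ^+ 2 / radius t ^+ 3)).
  rewrite I' (Rintegral_patch (h := fun r => r * G' r)); last first.
    by move=> r rN; rewrite /weighted_square' (negbTE rN) mulr0.
  by apply: eq_Rintegral => t; rewrite inE /shell/= => tD; rewrite /weighted_square' in_itv/= tD.
rewrite -E1 -E2.
have dI1 : is_derive (1 : R) (1 : R) I (derive1 I 1).
  by rewrite derive1E; exact: derivableP.
have h1 : is_derive (1 : R) (1 : R) (fun l => l ^+ N * I l) (N%:R * I 1 + derive1 I 1).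
  have hX : is_derive (1 : R) (1 : R) (fun l => l ^+ N) N%:R.
    by apply: DeriveDef; [exact: exprn_derivable|rewrite exp_derive expr1n /GRing.scale/= !mulr1].
  have := is_deriveM hX dI1.
  by rewrite /GRing.scale/= expr1n mul1r addrC [I 1 * _]mulrC.
have h2 : is_derive (1 : R) (1 : R) (fun l => l ^+ N * I l) 0.
  apply: (@near_eq_is_derive _ _ _ (cst (I 1))).
  near=> l; rewrite I_scale//.
  have : l \in `]1 / 2, 2[.
    near: l; apply: near_in_itvoo; rewrite in_itv/=; apply/andP; split; lra.
  by rewrite in_itv.
by case: h1 => _ <-; case: h2.
Unshelve. all: by end_near. Qed.

Let br := @bounded_measurable_radius R N R0 R1.
Let bV k := @bounded_measurable_radiusV R N R0 R1 R0_gt0 k.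

(** Expand the nonnegative integral of (g' + k g / r)^2 with k = (N - 2) / 2. The divergence
    identity evaluates the cross integral of g g' / r as - k c, and this value of k makes the
    resulting lower bound largest. *)
Lemma hardy_shell :
  ((N%:R - 2) / 2) ^+ 2 * \int[mu]_(t in D) (g (radius t) ^+ 2 / radius t ^+ 2)
  <= \int[mu]_(t in D) (g' (radius t) ^+ 2).
Proof.
set k : R := (N%:R - 2) / 2; set c := \int[mu]_(t in D) (g (radius t) ^+ 2 / radius t ^+ 2).
set a := \int[mu]_(t in D) _.
have bc : bounded_measurable D (fun t => g (radius t) ^+ 2 / radius t ^+ 2).
  by apply: bounded_measurableM => //; exact: bounded_measurableX.
have ba : bounded_measurable D (fun t => g' (radius t) ^+ 2) by exact: bounded_measurableX.
have bb : bounded_measurable D (fun t => g (radius t) * g' (radius t) * (radius t ^+ 1)^-1).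
  by apply: bounded_measurableM => //; exact: bounded_measurableM.
pose b := \int[mu]_(t in D) (g (radius t) * g' (radius t) * (radius t ^+ 1)^-1).
have r_neq0 t : t \in D -> radius t != 0.
  by rewrite inE => /andP[h _]; rewrite gt_eqF// (lt_trans R0_gt0).
have E : N%:R * c + (2 * b + (- 2) * c) = 0.
  rewrite -[RHS]shell_divergence -/c; congr (_ + _).
  rewrite /b /c -!RintegralZ_bounded//.
  rewrite -(RintegralD_bounded mD finD (bounded_measurableZ 2 bb) (bounded_measurableZ (-2) bc)).
  by apply: eq_Rintegral => t /r_neq0 t0; field.
have : 0 <= \int[mu]_(t in D) (g' (radius t) + k * (g (radius t) / radius t)) ^+ 2.
  by apply: Rintegral_ge0 => t _; exact: sqr_ge0.
have -> : \int[mu]_(t in D) (g' (radius t) + k * (g (radius t) / radius t)) ^+ 2 =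
    a + (2 * k * b + k ^+ 2 * c).
  rewrite /a /b /c -!RintegralZ_bounded//.
  have b1 := bounded_measurableZ (2 * k) bb.
  have b2 := bounded_measurableZ (k ^+ 2) bc.
  rewrite -(RintegralD_bounded mD finD b1 b2).
  rewrite -(RintegralD_bounded mD finD ba (bounded_measurableD b1 b2)).
  by apply: eq_Rintegral => t /r_neq0 t0; field.
have -> : 2 * k * b = - (2 * k ^+ 2 * c).
  have -> : b = - (k * c).
    by apply/eqP; rewrite -subr_eq0 opprK; apply/eqP; rewrite /k; lra.
  ring.
lra.
Qed.

End hardy.

(** * Expansions of real powers *)

Section powR_expansions.
Variable R : realType.
Implicit Types (q x y p k : R).

(** Both steps use 1 + y <= exp y: (1 + x)^q <= exp (q x) <= 1 / (1 - q x). A rational bound turns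
    the later comparisons into polynomial ones. *)
Lemma powR_le_inv q x : 0 <= q -> -1 < x -> q * x < 1 ->
  (1 + x) `^ q <= (1 - q * x)^-1.
Proof.
move=> q0 x1 qx; have x0 : 0 < 1 + x by lra.
rewrite /powR gt_eqF//; apply: (@le_trans _ _ (expR (q * x))).
  by rewrite ler_expR ler_wpM2l// le_ln1Dx.
rewrite -[q * x in leLHS]opprK expRN lef_pV2 ?posrE ?expR_gt0 ?subr_gt0//.
exact: expR_ge1Dx.
Qed.

(** This is the previous upper bound at y = - x / (1 + x), for which 1 + y is the inverse of 1 +
    x. *)
Lemma powR_ge_1D q x : 0 <= q -> 0 <= x -> 1 + q * x / (1 + x) <= (1 + x) `^ q.
Proof.
move=> q0 x0; have x1 : 0 < 1 + x by lra.
pose y := - (x / (1 + x)).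
have y1 : 1 + y = (1 + x)^-1 by rewrite /y; field; rewrite gt_eqF.
have qy : 0 <= q * x / (1 + x) by rewrite divr_ge0 ?mulr_ge0// ltW.
have E : (1 + x) `^ q * (1 + y) `^ q = 1.
  by rewrite -powRM ?y1 ?invr_ge0 ?(ltW x1)// divff ?gt_eqF// powR1.
have y_gt : -1 < y by rewrite -subr_gt0 opprK addrC y1 invr_gt0.
have q_y : q * y = - (q * x / (1 + x)) by rewrite /y mulrN mulrA.
have := powR_le_inv q0 y_gt _; rewrite q_y opprK => /(_ _)H.
have {}H : (1 + y) `^ q <= (1 + q * x / (1 + x))^-1 by apply: H; lra.
have py : 0 < (1 + y) `^ q by rewrite powR_gt0// y1 invr_gt0.
have -> : (1 + x) `^ q = ((1 + y) `^ q)^-1.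
  by apply: (mulIf (lt0r_neq0 py)); rewrite E mulVf ?lt0r_neq0.
rewrite -[leLHS]invrK lef_pV2 ?posrE ?invr_gt0//; lra.
Qed.

(** The difference h of the two sides vanishes at 0, and near 0 its derivative is nonpositive on the
    left and nonnegative on the right, so the mean value theorem gives h >= 0. The sign of h'
    follows from the two rational bounds at exponent p - 1. *)
Lemma powR_taylor2 p k : 2 <= p -> 0 < k -> k < p * (p - 1) / 2 ->
  exists2 d, 0 < d < 1 & forall x, `|x| <= d ->
    1 + p * x + k * x ^+ 2 <= (1 + x) `^ p.
Proof.
move=> p2 k0 kp; pose A := p * (p - 1) / (2 * k).
have A1 : 1 < A by rewrite /A ltr_pdivlMr ?mulr_gt0//; lra.
have q0 : 0 <= p - 1 by lra.
(* [A] > 1 measures how far [k] lies below the Taylor coefficient. The bound p |x| <= A - 1 absorbs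
   the error of the rational bounds, and |x| <= 1/2 keeps 1 + x away from 0. *)
pose d := Num.min 2^-1 ((A - 1) / p).
have d0 : 0 < d by rewrite lt_min invr_gt0 ltr0n/= divr_gt0//; lra.
have d1 : d <= 1 / 2 by rewrite ge_min; apply/orP; left; lra.
have dA : d * p <= A - 1.
  by rewrite -ler_pdivlMr; [rewrite ge_min lexx orbT|lra].
exists d => [|x xd]; first by apply/andP; split; lra.
pose h (z : R) : R := (1 + z) `^ p - (1 + p * z + k * z ^+ 2).
pose h' (z : R) : R := p * (1 + z) `^ (p - 1) - (p + 2 * k * z).
have kA : 2 * k * A = p * (p - 1) by rewrite /A; field; rewrite gt_eqF.
have dh (z : R) : -1 < z -> is_derive z (1 : R) h (h' z).
  move=> z1; have z0 : 0 < 1 + z by lra.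
  have h1 : is_derive z (1 : R) (fun z : R => 1 + z) 1.
    by have := is_deriveD (is_derive_cst (1 : R) z (1 : R)) (is_derive_id z (1 : R)); rewrite add0r.
  have h2 := @is_derive1_comp _ (fun w : R => w `^ p) (fun z : R => 1 + z) z _ _
    (is_derive1_powR p z0) h1.
  have h3 : is_derive z (1 : R) (fun z : R => 1 + p * z + k * z ^+ 2) (p + 2 * k * z).
    by apply: is_derive_eq; rewrite /GRing.scale/=; ring.
  by have := is_deriveB h2 h3; rewrite mulr1.
have h0 : h 0 = 0 by rewrite /h addr0 powR1 mulr0 expr0n mulr0 !addr0 subrr.
rewrite -subr_ge0 -/(h x).
have ch (a b : R) : -1 < a -> {within `[a, b], continuous h}.
  move=> a1; apply: derivable_within_continuous => z; rewrite in_itv/= => /andP[az _].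
  by case: (dh z (lt_le_trans a1 az)).
have dh' (a b : R) : -1 <= a -> forall z, z \in `]a, b[ -> is_derive z (1 : R) h (h' z).
  by move=> a1 z; rewrite in_itv/= => /andP[az _]; exact: dh (le_lt_trans a1 az).
have [x0|x0|->] := ltgtP x 0; last by rewrite h0.
- have xd' : - d <= x by move: xd; rewrite ler_norml => /andP[].
  have x1 : -1 < x by lra.
  have [c /[!in_itv]/= /andP[xc c0]] := @MVT _ h h' x 0 x0
    (dh' _ _ (ltW x1)) (ch _ _ x1).
  rewrite h0 sub0r => E; have -> : h x = h' c * x by lra.
  suff : h' c <= 0 by move=> ?; nra.
  have := @powR_le_inv (p - 1) c q0 _ _.
  move=> /(_ _ _)H; have {}H : (1 + c) `^ (p - 1) <= (1 - (p - 1) * c)^-1.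
    by apply: H; nra.
  have D0 : 0 < 1 - (p - 1) * c by nra.
  have : p * (1 - (p - 1) * c)^-1 <= p + 2 * k * c.
    have w : 0 <= A - 1 + (p - 1) * c by nra.
    have : 0 <= 2 * k * (- c) * (A - 1 + (p - 1) * c) by rewrite !mulr_ge0//; lra.
    have -> : 2 * k * (- c) * (A - 1 + (p - 1) * c) =
      - c * (2 * k * A) + 2 * k * c - 2 * k * (p - 1) * c ^+ 2 by ring.
    by rewrite kA ler_pdivrMr//; lra.
  have : p * (1 + c) `^ (p - 1) <= p * (1 - (p - 1) * c)^-1 by rewrite ler_pM2l//; lra.
  rewrite /h'; lra.
- have xd' : x <= d by move: xd; rewrite ler_norml => /andP[].
  have n1 : (-1 : R) < 0 by lra.
  have [c /[!in_itv]/= /andP[c0 cx]] := @MVT _ h h' 0 x x0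
    (dh' _ _ (ltW n1)) (ch _ _ n1).
  rewrite h0 !subr0 => E; have -> : h x = h' c * x by lra.
  suff : 0 <= h' c by move=> ?; nra.
  have H := @powR_ge_1D (p - 1) c q0 (ltW c0).
  have c1 : 0 < 1 + c by lra.
  have : p + 2 * k * c <= p * (1 + (p - 1) * c / (1 + c)).
    rewrite mulrDr mulr1 lerD2l mulrA ler_pdivlMr//.
    have w : 0 <= A - 1 - c by nra.
    have : 0 <= 2 * k * c * (A - 1 - c) by rewrite !mulr_ge0//; lra.
    have -> : 2 * k * c * (A - 1 - c) = c * (2 * k * A) - 2 * k * c - 2 * k * c ^+ 2 by ring.
    by rewrite kA; lra.
  have : p * (1 + (p - 1) * c / (1 + c)) <= p * (1 + c) `^ (p - 1) by rewrite ler_pM2l//; lra.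
  rewrite /h'; lra.
Qed.

Lemma powR_gap q a b : 0 < q -> 0 < a -> q * a < b ->
  exists2 d, 0 < d & forall s, 0 < s < d -> (1 + a * s ^+ 2) `^ q < 1 + b * s ^+ 2.
Proof.
move=> q0 a0 qab; have b0 : 0 < b by nra.
have C0 : 0 < q * a * b by rewrite !mulr_gt0.
(* With z = s^2, the three bounds give in turn z <= s, then q a b z < b - q a, which is (1 + b z) (1
   - q a z) > 1, and 1 - q a z > 0. *)
pose d := Num.min 1 (Num.min ((b - q * a) / (q * a * b)) (1 / (q * a))).
have qa0 : 0 < q * a by nra.
exists d => [|s /andP[s0]]; first by rewrite !lt_min ltr01/= !divr_gt0//; lra.
rewrite !lt_min => /andP[s1 /andP[]]; rewrite ltr_pdivlMr// => sd; rewrite ltr_pdivlMr// => sd'.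
pose z := s ^+ 2; have z0 : 0 < z by rewrite exprn_gt0.
have zs : z <= s by rewrite /z; nra.
rewrite -/z; have := @powR_le_inv q (a * z) (ltW q0) _ _.
move=> /(_ _ _)H; have {}H : (1 + a * z) `^ q <= (1 - q * (a * z))^-1.
  by apply: H; nra.
apply: (le_lt_trans H); rewrite -[X in X < _]mul1r ltr_pdivrMr; last by nra.
have : z * (q * a * b) < b - q * a by nra.
nra.
Qed.

End powR_expansions.

(** * Radial functions on the annulus *)

Section rowvector_derivatives.
Variables (R : realType) (n : nat).
Local Notation V := 'rV[R]_n.+1.
Implicit Types (x v : V) (i j : 'I_n.+1).

Lemma is_derive_coord x v j : is_derive x v (fun y : V => y 0 j) (v 0 j).
Proof.
apply: DeriveDef; first exact/diff_derivable/differentiable_coord.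
apply: cvg_lim => //; apply: (@cvg_near_cst).
near=> h; rewrite /= !mxE addrK.
have h0 : h != 0 by near: h; exact: nbhs_dnbhs_neq.
by rewrite /GRing.scale/= mulrA mulVf// mul1r.
Unshelve. all: by end_near. Qed.

(** Restriction to the line through [x] of direction [v] reduces this to the chain rule in one
    variable, so a single directional derivative of [f] is enough. *)
Lemma is_derive_comp_real (f : V -> R) (phi : R -> R) x v (a b : R) :
  is_derive x v f a -> is_derive (f x) (1 : R) phi b ->
  is_derive x v (fun y => phi (f y)) (b * a).
Proof.
have line (F : V -> R) (l : R) : is_derive x v F l <->
    is_derive (0 : R) (1 : R) (fun h : R => F (h *: v + x)) l.
  have E : 'D_v F x = 'D_1 (fun h : R => F (h *: v + x)) 0.
    rewrite /derive; set g1 := fun h => h^-1 *: _; set g2 := fun h => h^-1 *: _.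
    suff -> : g1 = g2 by []; rewrite funeqE /g1 /g2 => h /=.
    by rewrite addr0 scale0r add0r [_%:A]mulr1.
  split=> -[dF <-].
    by apply: DeriveDef; [exact: (derivable1P _ _ _).1 dF|rewrite E].
  by apply: DeriveDef; [exact: (derivable1P _ _ _).2 dF|rewrite E].
move=> /line df dphi; apply/line.
apply: (@is_derive1_comp _ phi (fun h : R => f (h *: v + x))) => //.
by rewrite scale0r add0r.
Qed.

Definition sumsq x : R := \sum_i x 0 i ^+ 2.

Lemma is_derive_sumsq x v : is_derive x v sumsq (2 * \sum_i x 0 i * v 0 i).
Proof.
have -> : sumsq = \sum_(i < n.+1) (fun y : V => y 0 i ^+ 2).
  by apply/funext => y; rewrite fct_sumE.
rewrite mulr_sumr; apply: is_derive_sum => i.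
have := is_deriveX 2 (is_derive_coord x v i).
by rewrite /GRing.scale/= expr1 mulrA.
Qed.

Lemma differentiable_sumsq x : differentiable sumsq x.
Proof.
have -> : sumsq = \sum_(i < n.+1) (fun y : V => y 0 i ^+ 2).
  by apply/funext => y; rewrite fct_sumE.
by apply: differentiable_sum => i; exact: (@differentiableX _ _ _ 1 _ (differentiable_coord x 0 i)).
Qed.

Lemma enorm_continuous : continuous (@enorm R n.+1).
Proof.
move=> x; apply: (@continuous_comp _ _ _ sumsq Num.sqrt).
  exact/differentiable_continuous/differentiable_sumsq.
exact: sqrt_continuous.
Qed.

Lemma is_derive_enorm x v : 0 < enorm x ->
  is_derive x v (@enorm R n.+1) ((\sum_i x 0 i * v 0 i) / enorm x).
Proof.
move=> x0; have s0 : 0 < sumsq x by move: x0; rewrite sqrtr_gt0.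
have := is_derive_comp_real (is_derive_sumsq x v) (is_derive1_sqrt s0).
rewrite -/(enorm x).
suff -> : (2 * enorm x)^-1 * (2 * \sum_i x 0 i * v 0 i) =
  (\sum_i x 0 i * v 0 i) / enorm x by [].
by field; rewrite gt_eqF.
Qed.

End rowvector_derivatives.

Section annulus_topology.
Variables (R : realType) (n : nat) (R0 R1 : R).
Local Notation V := 'rV[R]_n.+1.
Local Notation A := (@annulus R n.+1 R0 R1).
Hypotheses (R0_gt0 : 0 < R0) (R01 : R0 < R1).

Lemma annulus_open : open A.
Proof.
have -> : A = @enorm R n.+1 @^-1` `]R0, R1[.
  by apply/seteqP; split => x; rewrite /annulus/= in_itv.
apply: open_comp; first by move=> x _; exact: enorm_continuous.
exact: interval_open.
Qed.

Lemma closure_annulus : closure A = [set x | R0 <= enorm x <= R1].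
Proof.
apply/seteqP; split.
  have -> : [set x | R0 <= enorm x <= R1] = @enorm R n.+1 @^-1` `[R0, R1].
    by apply/seteqP; split => x /=; rewrite in_itv.
  have cl : closed (@enorm R n.+1 @^-1` `[R0, R1]).
    apply: preimage_closed; first by move=> x _; exact: enorm_continuous.
    exact: interval_closed.
  rewrite ((closure_id _).1 cl); apply: closureS => x /andP[a b] /=.
  by rewrite in_itv/= !ltW.
move=> x /andP[x0 x1]; have xpos := lt_le_trans R0_gt0 x0.
pose m := (R0 + R1) / 2.
(* For e in ]0, 1[ this point, on the ray of x towards the middle sphere, is in A. *)
pose y (e : R) : V := ((enorm x + e * (m - enorm x)) / enorm x) *: x.
have yA e : 0 < e < 1 -> A (y e).
  move=> /andP[e0 e1]; rewrite /annulus/= /y.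
  have [h0 h1] := (R0_gt0, R01).
  have m0 : R0 < m by rewrite /m; lra.
  have m1 : m < R1 by rewrite /m; lra.
  have s0 : 0 < enorm x + e * (m - enorm x) by nra.
  rewrite enormZ ?divr_ge0 ?(ltW s0) ?(ltW xpos)// divfK ?gt_eqF//.
  by apply/andP; split; nra.
have cy : y e @[e --> (0 : R)] --> x.
  have E : y 0 = x by rewrite /y mul0r addr0 divff ?gt_eqF// scale1r.
  rewrite -[X in _ --> X]E; apply: cvgZl.
  apply: cvgM; last exact: cvg_cst.
  apply: cvgD; first exact: cvg_cst.
  by apply: cvgM; [exact: cvg_id|exact: cvg_cst].
move=> B Bx; have /= := cy B Bx => /nbhs_ballP[d d0 dB].
pose e := Num.min (d / 2) (1 / 2).
have e0 : 0 < e by rewrite lt_min !divr_gt0.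
exists (y e); split.
  by apply: yA; rewrite e0/= gt_min; apply/orP; right; lra.
apply: dB; rewrite /ball/= sub0r normrN gtr0_norm// gt_min; apply/orP; left.
by move: d0 => /= d0; lra.
Qed.

Lemma annulus_sub_closure : A `<=` closure A.
Proof. exact: subset_closure. Qed.

End annulus_topology.

Section radial_profile.
Variables (R : realType) (n : nat) (R0 R1 : R).
Local Notation V := 'rV[R]_n.+1.
Local Notation A := (@annulus R n.+1 R0 R1).
Hypotheses (R0_gt0 : 0 < R0) (R01 : R0 < R1).

Let e : V := delta_mx 0 ord_max.

Let enorm_e : enorm e = 1.
Proof.
rewrite /enorm (bigD1 ord_max)//= mxE !eqxx expr1n big1 ?addr0 ?sqrtr1// => i ni.
by rewrite mxE (negbTE ni) andbF expr0n.
Qed.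

Let enorm_line r : 0 <= r -> enorm (r *: e) = r.
Proof. by move=> r0; rewrite enormZ// enorm_e mulr1. Qed.

Let line_closure r : r \in `[R0, R1] -> closure A (r *: e).
Proof.
rewrite in_itv/= closure_annulus// => /andP[a b] /=.
by rewrite enorm_line ?a// (le_trans (ltW R0_gt0)).
Qed.

Let line_annulus r : r \in `]R0, R1[ -> A (r *: e).
Proof.
rewrite in_itv/= /annulus => /andP[a b] /=.
by rewrite enorm_line ?a// ltW// (lt_trans R0_gt0).
Qed.

Lemma closure_annulus_enorm r : r \in `[R0, R1] ->
  exists2 x, closure A x & enorm x = r.
Proof.
move=> rin; exists (r *: e); first exact: line_closure.
by move: rin; rewrite in_itv/= => /andP[a _]; rewrite enorm_line// (le_trans (ltW R0_gt0)).
Qed.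

Let within_line (h : V -> R) : {within closure A, continuous h} ->
  {within `[R0, R1], continuous (fun r => h (r *: e))}.
Proof.
move=> /subspace_continuousP ch; apply/subspace_continuousP => r rin.
have := ch _ (line_closure rin) => hc P Pr.
have cl : (s *: e) @[s --> r] --> r *: e by exact: scalel_continuous.
have := cl _ (hc P Pr); rewrite /= !nbhs_simpl /=.
apply: filterS => s hs sin; exact: hs (line_closure sin).
Qed.

(** The function provided by [radial] carries no regularity, so the profile is read off from [u]
    along the last coordinate axis. Its derivative is the continuous extension of the last partial
    derivative on that axis, which gives continuity of g' up to [R0] and [R1]. *)
Lemma radial_C10_profile (u : V -> R) : C10 A u -> radial (closure A) u ->
  exists g g' : R -> R,
  [/\ {within `[R0, R1], continuous g}, {within `[R0, R1], continuous g'},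
      forall r, r \in `]R0, R1[ -> is_derive r (1 : R) g (g' r),
      g R0 = 0 /\ g R1 = 0 &
      (forall x, closure A x -> u x = g (enorm x)) /\
      (forall x i, A x -> partial i u x = g' (enorm x) * (x 0 i / enorm x))].
Proof.
move=> [[cu du pu] u0] [f uf].
have [h [ch hE]] := pu ord_max.
have ug x : closure A x -> u x = u (enorm x *: e).
  move=> Ax; rewrite (uf _ Ax) uf; last first.
    by apply: line_closure; move: Ax; rewrite closure_annulus.
  by rewrite enorm_line// enorm_ge0.
have dg r : r \in `]R0, R1[ -> is_derive r (1 : R) (fun r => u (r *: e)) (h (r *: e)).
  move=> rin; have Ar := line_annulus rin; rewrite (hE _ Ar) /partial -/e.
  have duv := diff_derivable (v := e) (du _ Ar).
  have E : (fun s : R => s^-1 *: (((fun r : R => u (r *: e)) \o shift r) (s *: (1 : R)) - u (r *: e)))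
      = (fun s : R => s^-1 *: ((u \o shift (r *: e)) (s *: e) - u (r *: e))).
    by apply/funext => s /=; rewrite [_%:A]mulr1 scalerDl.
  apply: DeriveDef; first by rewrite /derivable E.
  by rewrite /derive E.
have bd x : (closure A `\` A) x -> u x = 0.
  by move=> [xc xA]; apply: u0; split => //; rewrite (interior_id _).1//; exact: annulus_open.
exists (fun r => u (r *: e)), (fun r => h (r *: e)); split.
- exact: within_line.
- exact: within_line.
- exact: dg.
- split; apply: bd; (split; [apply: line_closure; rewrite in_itv/= lexx ltW//|]).
    by rewrite /annulus/= enorm_line ?ltxx// ltW.
  by rewrite /annulus/= enorm_line ?ltxx ?andbF// ltW// (lt_trans R0_gt0).
split => // x i Ax.
have x0 : 0 < enorm x by move: Ax => /andP[+ _]; exact: lt_trans.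
have near_u : \forall y \near x, u (enorm y *: e) = u y.
  have : nbhs x A by apply: open_nbhs_nbhs; split => //; exact: annulus_open.
  by apply: filterS => y Ay; rewrite -ug//; exact: annulus_sub_closure.
have xin : enorm x \in `]R0, R1[ by rewrite in_itv.
have := is_derive_comp_real (is_derive_enorm (delta_mx 0 i) x0) (dg _ xin).
move=> /(near_eq_is_derive near_u) [_]; rewrite /partial => ->.
congr (_ * (_ / _)); rewrite (bigD1 i)//= mxE !eqxx mulr1 big1 ?addr0// => j ji.
by rewrite mxE (negbTE ji) andbF mulr0.
Qed.

Lemma continuous_itv_bounded (f : R -> R) : {within `[R0, R1], continuous f} ->
  exists M, forall r, r \in `[R0, R1] -> `|f r| <= M.
Proof.
move=> cf; have [a _ fa] := EVT_max (ltW R01) cf; have [b _ fb] := EVT_min (ltW R01) cf.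
exists (Num.max `|f a| `|f b|) => r rin.
have h1 := fa _ rin; have h2 := fb _ rin.
rewrite le_max; have [f0|f0] := leP 0 (f r).
  by rewrite (ger0_norm f0) (le_trans h1)// ler_norm.
rewrite (ltr0_norm f0) orbC (_ : - f r <= `|f b|)//.
by rewrite -normrN (le_trans _ (ler_norm _))// lerN2.
Qed.

Lemma bounded_measurable_profile (f : R -> R) :
  {within `[R0, R1], continuous f} ->
  bounded_measurable (@shell R n.+1 R0 R1) (fun t => f (radius t)).
Proof.
move=> cf; split.
  have mf : measurable_fun `]R0, R1[ f.
    apply: (@measurable_funS _ _ _ _ `[R0, R1]%classic) => //.
      exact: subset_itv_oo_cc.
    exact: subspace_continuous_measurable_fun.
  apply: (measurable_comp (F := `]R0, R1[%classic)) => //.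
    by move=> _ [t tD <-]; rewrite /= in_itv.
  by apply: measurable_funTS; exact: measurable_radius.
have [M fM] := continuous_itv_bounded cf; exists M => t /andP[a b].
by apply: fM; rewrite in_itv/= !ltW.
Qed.

End radial_profile.

(** * The axial harmonic and the test functions *)

Section axial_harmonic.
Variables (R : realType) (n : nat).
Local Notation V := 'rV[R]_n.+1.
Local Notation N := (n.+1%:R : R).
Implicit Types (x : V) (i : 'I_n.+1).

Definition axial_sqr x : R := x 0 ord_max ^+ 2 / sumsq x.

(* |x|^2 times this function is a harmonic polynomial of degree 2, so that it
   is an eigenfunction of the Laplacian of the sphere, of eigenvalue 2 N. *)
Definition axial_harmonic x : R := 1 - N * axial_sqr x.

Definition axial_sqr_partial i x : R :=
  2 * x 0 ord_max * (i == ord_max)%:R / sumsq x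
  - 2 * x 0 ord_max ^+ 2 * x 0 i / sumsq x ^+ 2.

Lemma enorm_sumsq x : enorm x ^+ 2 = sumsq x.
Proof. exact: enorm_sqr. Qed.

Lemma sumsq_gt0 x : 0 < enorm x -> 0 < sumsq x.
Proof. by rewrite sqrtr_gt0. Qed.

Lemma axial_sqr_ge0 x : 0 <= axial_sqr x.
Proof. by rewrite divr_ge0 ?sqr_ge0// -enorm_sumsq sqr_ge0. Qed.

Lemma axial_sqr_le1 x : axial_sqr x <= 1.
Proof.
have [s0|s0] := ltP 0 (sumsq x).
  rewrite ler_pdivrMr// mul1r /sumsq (bigD1 ord_max)//= lerDl.
  by apply: sumr_ge0 => i _; exact: sqr_ge0.
rewrite /axial_sqr; have -> : sumsq x = 0; [by apply/eqP; rewrite eq_le s0 -enorm_sumsq sqr_ge0|by rewrite invr0 mulr0 ler01].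
Qed.

Lemma is_derive_axial_sqr i x : 0 < enorm x ->
  is_derive x (delta_mx 0 i : V) axial_sqr (axial_sqr_partial i x).
Proof.
move=> x0; have s0 := sumsq_gt0 x0; have s_neq0 := lt0r_neq0 s0.
have dV : is_derive (sumsq x) (1 : R) (fun y : R => y^-1) (- (sumsq x) ^- 2).
  have := @is_deriveV R id (sumsq x) (1 : R) (1 : R) s_neq0 (is_derive_id _ _).
  by rewrite /GRing.scale/= mulr1.
have h1 := is_derive_comp_real (is_derive_sumsq x (delta_mx 0 i : V)) dV.
have h2 := is_deriveX 2 (is_derive_coord x (delta_mx 0 i : V) ord_max).
have := is_deriveM h2 h1.
suff -> : ((fun y : V => y 0 ord_max) ^+ 2) x *: (- sumsq x ^- 2 *
      (2 * \sum_j x 0 j * (delta_mx 0 i : V) 0 j)) +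
    (sumsq x)^-1 *: ((2 * x 0 ord_max ^+ 1) *: (delta_mx 0 i : V) 0 ord_max) =
    axial_sqr_partial i x by [].
have -> : \sum_j x 0 j * (delta_mx 0 i : V) 0 j = x 0 i.
  rewrite (bigD1 i)//= mxE !eqxx mulr1 big1 ?addr0// => j ji.
  by rewrite mxE (negbTE ji) andbF mulr0.
rewrite mxE eqxx/= [ord_max == i]eq_sym /GRing.scale/= expr1 exprfctE.
by rewrite /axial_sqr_partial; field.
Qed.

Lemma differentiable_axial_sqr x : 0 < enorm x -> differentiable axial_sqr x.
Proof.
move=> x0; have s_neq0 := lt0r_neq0 (sumsq_gt0 x0).
apply: differentiableM.
  exact: (@differentiableX _ _ _ 1 _ (differentiable_coord x 0 ord_max)).
exact: differentiableV (differentiable_sumsq x) s_neq0.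
Qed.

(** Euler's identity for a function homogeneous of degree 0: its gradient is tangent to the
    spheres. *)
Lemma sum_coord_axial_partial x : 0 < enorm x ->
  \sum_i x 0 i * axial_sqr_partial i x = 0.
Proof.
move=> x0; have s_neq0 := lt0r_neq0 (sumsq_gt0 x0).
rewrite (bigD1 ord_max)//= (eq_bigr (fun i =>
  - (2 * x 0 ord_max ^+ 2 / sumsq x ^+ 2) * x 0 i ^+ 2)); last first.
  by move=> i /negbTE ni; rewrite /axial_sqr_partial ni mulr0n; field.
rewrite -mulr_sumr; set S := \sum_(i | _) _.
have -> : S = sumsq x - x 0 ord_max ^+ 2 by rewrite /sumsq (bigD1 ord_max)//= addrAC subrr add0r.
by rewrite /axial_sqr_partial eqxx mulr1n; field.
Qed.

(** With q = sin^2 theta and a tangential gradient, this is (dq / dtheta)^2 / r^2 = 4 sin^2 theta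
    cos^2 theta / r^2. *)
Lemma sum_axial_partial_sqr x : 0 < enorm x ->
  \sum_i axial_sqr_partial i x ^+ 2 =
  4 * (axial_sqr x - axial_sqr x ^+ 2) / sumsq x.
Proof.
move=> x0; have s_neq0 := lt0r_neq0 (sumsq_gt0 x0).
rewrite (bigD1 ord_max)//= (eq_bigr (fun i =>
  (4 * x 0 ord_max ^+ 4 / sumsq x ^+ 4) * x 0 i ^+ 2)); last first.
  by move=> i /negbTE ni; rewrite /axial_sqr_partial ni mulr0n; field.
rewrite -mulr_sumr; set S := \sum_(i | _) _.
have -> : S = sumsq x - x 0 ord_max ^+ 2 by rewrite /sumsq (bigD1 ord_max)//= addrAC subrr add0r.
by rewrite /axial_sqr_partial /axial_sqr eqxx mulr1n; field.
Qed.

Lemma sin_polar_angle_sqr x : 0 < enorm x -> sin (polar_angle x) ^+ 2 = axial_sqr x.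
Proof.
move=> x0; rewrite /polar_angle asinK.
  by rewrite expr_div_n enorm_sumsq.
rewrite in_itv/= -ler_norml normrM normfV (gtr0_norm x0) ler_pdivrMr// mul1r.
exact: coord_le_enorm.
Qed.

End axial_harmonic.

Section test_function.
Variables (R : realType) (n : nat) (R0 R1 : R).
Local Notation V := 'rV[R]_n.+1.
Local Notation N := (n.+1%:R : R).
Local Notation A := (@annulus R n.+1 R0 R1).
Variables (u : V -> R) (g g' : R -> R) (tau s : R).
Hypotheses (R0_gt0 : 0 < R0) (R01 : R0 < R1).
Hypotheses (u_C10 : C10 A u) (g_ge0 : forall r, r \in `[R0, R1] -> 0 <= g r).
Hypothesis u_profile : forall x, closure A x -> u x = g (enorm x).
Hypothesis u_partial : forall x i, A x ->
  partial i u x = g' (enorm x) * (x 0 i / enorm x).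
Hypotheses (tau_ge0 : 0 <= tau) (s_ge0 : 0 <= s) (sN : s * N <= 1).

(** The parameter [s] selects the deformation and [tau] is the multiple that later places it on the
    Nehari set. The value tau = 1, s = 0 gives [u] back. *)
Definition axial_perturbation (x : V) : R :=
  tau * (u x * (1 + s * axial_harmonic x)).

Local Notation v := axial_perturbation.

Let clA x : closure A x -> 0 < enorm x.
Proof. by rewrite closure_annulus// => /andP[a _]; exact: lt_le_trans a. Qed.

(** The harmonic is at least 1 - N, so s N <= 1 leaves the margin [s]. A positive margin keeps the
    test function nonzero wherever [u] is. *)
Lemma axial_factor_ge (x : V) : s <= 1 + s * axial_harmonic x.
Proof.
have := axial_sqr_le1 x; have := axial_sqr_ge0 x; have := s_ge0; have := sN.
rewrite /axial_harmonic; set q := axial_sqr x => h1 h2 h3 h4.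
have : s * N * q <= 1 * 1 by rewrite ler_pM// mulr_ge0.
have -> : 1 + s * (1 - N * q) = 1 + s - s * N * q by ring.
lra.
Qed.

Lemma axial_factor_ge0 (x : V) : 0 <= 1 + s * axial_harmonic x.
Proof. exact: le_trans (axial_factor_ge x). Qed.

Let is_derive_v i x : A x -> is_derive x (delta_mx 0 i : V) v
  (tau * (partial i u x * (1 + s * axial_harmonic x) +
    u x * (s * - (N * axial_sqr_partial i x)))).
Proof.
move=> Ax; have x0 := clA (annulus_sub_closure Ax).
have [[_ du _] _] := u_C10.
have hu : is_derive x (delta_mx 0 i : V) u (partial i u x).
  exact/derivableP/diff_derivable/du.
have hq := is_derive_axial_sqr i x0.
have dphi : is_derive (axial_sqr x) (1 : R) (fun q : R => 1 + s * (1 - N * q)) (s * - N).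
  have h : is_derive (axial_sqr x) (1 : R) (fun q : R => (1 + s) + (- (s * N)) * q) (0 + (- (s * N)) *: (1 : R)).
    apply: is_deriveD; exact: is_deriveZ.
  have -> : (fun q : R => 1 + s * (1 - N * q)) = (fun q : R => (1 + s) + (- (s * N)) * q).
    by apply/funext => q; ring.
  by move: h; rewrite /GRing.scale/= add0r mulr1 mulrN.
have hY := is_derive_comp_real hq dphi.
have := is_deriveZ tau (is_deriveM hu hY).
set l := (X in is_derive _ _ _ X -> _); set r := (X in _ -> is_derive _ _ _ X).
suff -> : l = r by [].
by rewrite /l /r /GRing.scale/= /axial_harmonic; ring.
Qed.

(** The gradient of [u] is radial and that of the harmonic tangential, so there is no cross term. *)
Lemma sqgrad_axial_perturbation x : A x -> sqgrad v x =
  tau ^+ 2 * (g' (enorm x) ^+ 2 * (1 + s * axial_harmonic x) ^+ 2 +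
    s ^+ 2 * (N ^+ 2 * (4 * (g (enorm x) ^+ 2 *
      (axial_sqr x - axial_sqr x ^+ 2) / enorm x ^+ 2)))).
Proof.
move=> Ax; have xcl := annulus_sub_closure Ax; have x0 := clA xcl.
have r0 := lt0r_neq0 x0.
pose a := g' (enorm x) * (1 + s * axial_harmonic x) / enorm x.
pose b := - (N * s * g (enorm x)).
transitivity (\sum_i tau ^+ 2 * (a ^+ 2 * x 0 i ^+ 2 +
    (2 * a * b) * (x 0 i * axial_sqr_partial i x) + b ^+ 2 * axial_sqr_partial i x ^+ 2)).
  apply: eq_bigr => i _; rewrite /partial; have [_ ->] := is_derive_v i Ax.
  by rewrite u_partial// u_profile// /a /b; ring.
rewrite -mulr_sumr !big_split/= -!mulr_sumr -/(sumsq x).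
rewrite sum_coord_axial_partial// sum_axial_partial_sqr// -enorm_sumsq.
by rewrite /a /b; field.
Qed.

Let differentiable_factor x : 0 < enorm x ->
  differentiable (fun y : V => 1 + s * axial_harmonic y) x.
Proof.
move=> x0.
have -> : (fun y : V => 1 + s * axial_harmonic y) =
    cst (1 + s) + (- (s * N)) *: (@axial_sqr R n : V -> R).
  apply/funext => y; rewrite -[RHS]/((1 + s) + (- (s * N)) * axial_sqr y).
  by rewrite /axial_harmonic; ring.
apply: differentiableD => //; apply: differentiableZ.
exact: differentiable_axial_sqr.
Qed.

Let differentiable_partial i x : 0 < enorm x ->
  {for x, continuous (fun y : V => s * - (N * axial_sqr_partial i y))}.
Proof.
move=> x0; have s0 := lt0r_neq0 (sumsq_gt0 x0).
have cs : continuous_at x (@sumsq R n) := differentiable_continuous (differentiable_sumsq x).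
have cc j : continuous_at x (fun y : V => y 0 j) := differentiable_continuous (differentiable_coord x 0 j).
have cV k : continuous_at x (fun y : V => (sumsq y ^+ k)^-1).
  apply: (continuousV _ (continuous_comp cs (@exprn_continuous R k _))).
  by rewrite /= expf_neq0.
apply: continuousM; first exact: cst_continuous.
apply: continuousN; apply: continuousM; first exact: cst_continuous.
apply: continuousB.
  apply: continuousM; last exact: (cV 1%N).
  apply: continuousM; last exact: cst_continuous.
  by apply: continuousM; [exact: cst_continuous|exact: cc].
apply: continuousM; last exact: (cV 2%N).
apply: continuousM; last exact: cc.
apply: continuousM; first exact: cst_continuous.
exact: (continuous_comp (cc _) (@exprn_continuous R 2 _)).
Qed.

Let within_mul (f h : V -> R) : {within closure A, continuous f} ->
  {within closure A, continuous h} ->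
  {within closure A, continuous (fun x => f x * h x)}.
Proof. by move=> cf ch x; apply: cvgM; [exact: cf|exact: ch]. Qed.

Let within_add (f h : V -> R) : {within closure A, continuous f} ->
  {within closure A, continuous h} ->
  {within closure A, continuous (fun x => f x + h x)}.
Proof. by move=> cf ch x; apply: cvgD; [exact: cf|exact: ch]. Qed.

Let within_cst (c : R) : {within closure A, continuous (fun _ : V => c)}.
Proof. by move=> x; exact: cvg_cst. Qed.

Lemma C10_axial_perturbation : C10 A v.
Proof.
have [[cu du pu] u0] := u_C10.
have cY : {within closure A, continuous (fun y : V => 1 + s * axial_harmonic y)}.
  apply: continuous_in_subspaceT => x /[!inE] /clA x0.
  exact/differentiable_continuous/differentiable_factor.
split; last by move=> x hx; rewrite /v u0// mul0r mulr0.
split.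
- by apply: within_mul => //; exact: within_mul.
- move=> x Ax; apply: differentiableM => //; apply: differentiableM; first exact: du.
  exact/differentiable_factor/clA/annulus_sub_closure.
- move=> i; have [h [ch hE]] := pu i.
  exists (fun x => tau * (h x * (1 + s * axial_harmonic x) +
    u x * (s * - (N * axial_sqr_partial i x)))); split.
    apply: within_mul => //; apply: within_add; first exact: within_mul.
    apply: within_mul => //; apply: continuous_in_subspaceT => x /[!inE] /clA x0.
    exact: differentiable_partial.
  by move=> x Ax; rewrite hE// /partial; case: (is_derive_v i Ax) => _ ->.
Qed.

Lemma axial_perturbation_ge0 x : closure A x -> 0 <= v x.
Proof.
move=> xA; rewrite mulr_ge0// mulr_ge0 ?axial_factor_ge0// u_profile//.
by apply: g_ge0; move: xA; rewrite closure_annulus.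
Qed.

Lemma coneK_axial_perturbation : coneK R0 R1 v.
Proof.
split; [exact: C10_axial_perturbation|exact: axial_perturbation_ge0|].
exists (fun r theta => tau * (g r * (1 + s * (1 - N * sin theta ^+ 2)))); split.
- move=> x xA; rewrite /v /axial_harmonic u_profile//.
  by rewrite -sin_polar_angle_sqr// clA.
- by move=> r t _ _; rewrite sinN sqrrN.
- move=> r t rR /andP[t0 tpi].
  have d : is_derive t (1 : R) (fun t => tau * (g r * (1 + s * (1 - N * sin t ^+ 2))))
     (- (2 * tau * g r * s * N) * (sin t * cos t)).
    have -> : (fun t => tau * (g r * (1 + s * (1 - N * sin t ^+ 2)))) =
       (fun t => tau * g r * (1 + s) + - (tau * g r * s * N) * sin t ^+ 2).
      by apply/funext => y; ring.
    have h := is_deriveX 2 (is_derive_sin t).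
    have := is_deriveD (is_derive_cst (tau * g r * (1 + s)) t (1 : R))
      (is_deriveZ (- (tau * g r * s * N)) h).
    set l := (X in is_derive _ _ _ X -> _); set rr := (X in _ -> is_derive _ _ _ X).
    suff -> : l = rr by [].
    by rewrite /l /rr /GRing.scale/=; ring.
  split; first by case: d.
  rewrite derive1E; case: d => _ ->; rewrite mulNr oppr_le0.
  have sg : 0 <= sin t by apply: sin_ge0_pi; rewrite ltW//=; have := pi_gt0 R; lra.
  have cg : 0 <= cos t by apply: cos_ge0_pihalf; apply/andP; split; have := pi_gt0 R; lra.
  by rewrite !mulr_ge0// g_ge0// in_itv.
Qed.

End test_function.

(** * Energies *)

Section energy_ray.
Variables (R : realType) (n : nat) (R0 R1 p : R).
Local Notation V := 'rV[R]_n.+1.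
Local Notation A := (@annulus R n.+1 R0 R1).
Local Notation D := (@shell R n.+1 R0 R1).
Hypothesis p_gt0 : 0 < p.
Variable v : V -> R.
Hypothesis dv : forall x, A x -> differentiable v x.
Hypothesis bQ : bounded_measurable D
  (fun t => sqgrad v (rV_of_tuple t) + v (rV_of_tuple t) ^+ 2).
Hypothesis bP : bounded_measurable D (fun t => `|v (rV_of_tuple t)| `^ p).

Local Notation Q := (integral_rV A (fun x => sqgrad v x + v x ^+ 2)).
Local Notation P := (integral_rV A (fun x => `|v x| `^ p)).

Lemma energy_ray h : energy p A (fun x => v x + h * v x) =
  2^-1 * ((1 + h) ^+ 2 * Q) - p^-1 * (`|1 + h| `^ p * P).
Proof.
have mD := @measurable_shell R n.+1 R0 R1.
have fD := @shell_finite R n.+1 R0 R1.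
rewrite /energy /integral_rV; congr (_ * _ - _ * _).
  rewrite -RintegralZ_bounded//; apply: eq_Rintegral => t; rewrite inE => /= At.
  rewrite mulrDr; congr (_ + _); last by ring.
  rewrite /sqgrad mulr_sumr; apply: eq_bigr => i _; rewrite /partial -exprMn; congr (_ ^+ 2).
  have -> : (fun x : V => v x + h * v x) = (1 + h) *: v.
    by apply/funext => x; rewrite -[RHS]/((1 + h) * v x); ring.
  by rewrite deriveZ//; exact/diff_derivable/dv.
rewrite -RintegralZ_bounded//; apply: eq_Rintegral => t _.
by rewrite -powRM// -normrM; congr (`|_| `^ p); ring.
Qed.

(** The Nehari condition only involves the ray through [v], on which the energy is the explicit
    function (1 + h)^2 Q / 2 - |1 + h|^p P / p. Near h = 0 the absolute value disappears. *)
Lemma is_denergy_ray : is_denergy p A v v (Q - P).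
Proof.
rewrite /is_denergy; under [X in is_derive _ _ X]eq_fun do rewrite energy_ray.
apply: (@near_eq_is_derive _ _ _
  (fun h : R => 2^-1 * ((1 + h) ^+ 2 * Q) - p^-1 * ((1 + h) `^ p * P))).
  near=> h; have h1 : 0 <= 1 + h.
    have : -1 < h by near: h; apply: lt_nbhsr; rewrite ltrN10.
    by rewrite -subr_gt0 opprK addrC => /ltW.
  by rewrite (ger0_norm h1).
have dX : is_derive (0 : R) (1 : R) (fun h : R => 1 + h) 1.
  by have := is_deriveD (is_derive_cst (1 : R) (0 : R) (1 : R)) (is_derive_id (0 : R) (1 : R)); rewrite add0r.
have d2 := is_deriveX 2 dX.
have p1 : 0 < 1 + (0 : R) by rewrite addr0.
have d3 := @is_derive1_comp _ (fun w : R => w `^ p) (fun h : R => 1 + h) 0 _ _ (is_derive1_powR p p1) dX.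
have := is_deriveB (is_deriveZ (2^-1 * Q) d2) (is_deriveZ (p^-1 * P) d3).
set F := (X in is_derive _ _ X _ -> _); set G := (X in _ -> is_derive _ _ X _).
have -> : F = G.
  apply/funext => h; rewrite /F /G.
  rewrite -[LHS]/((2^-1 * Q) * (1 + h) ^+ 2 - (p^-1 * P) * (1 + h) `^ p).
  by ring.
set a := (X in is_derive _ _ _ X -> _); suff -> : a = Q - P by [].
rewrite /a /GRing.scale/= addr0 powR1 expr1; field.
by rewrite gt_eqF.
Unshelve. all: by end_near. Qed.

End energy_ray.

Section shell_positive.
Variables (R : realType) (n : nat).
Local Notation RT := (measurableTypeR R).
Local Notation V := 'rV[R]_n.+1.

(** The topology is that of the sup norm, so a ball around a point of the open annulus is a box,
    whose measure is a product of lengths. *)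
Lemma shell_measure_gt0 a b : 0 < a -> a < b ->
  (0 < lebesgue_tuple R n.+1 (@shell R n.+1 a b))%E.
Proof.
move=> a0 ab; pose r := (a + b) / 2.
have [x _ xr] := @closure_annulus_enorm R n a b a0 ab r (ltac:(rewrite in_itv/= /r; apply/andP; split; lra)).
have Ax : @annulus R n.+1 a b x by rewrite /annulus/= xr /r; apply/andP; split; lra.
have : nbhs x (@annulus R n.+1 a b).
  by apply: open_nbhs_nbhs; split => //; exact: annulus_open.
move=> /nbhs_ballP[e /= e0 eA].
pose B (i : 'I_n.+1) : set RT := `]x 0 i - e, x 0 i + e[%classic.
have mB i : measurable (B i) by exact: measurable_itv.
apply: (@lt_le_trans _ _ (lebesgue_tuple R n.+1 [set t | forall i, B i (tnth t i)])).
  rewrite lebesgue_tuple_box//.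
  elim: (index_enum _) => [|i s IH]; first by rewrite big_nil lte01.
  rewrite big_cons mule_gt0// /B lebesgue_measure_itv/= lte_fin ifT.
    by rewrite -EFinD lte_fin; lra.
  lra.
apply: le_measure; rewrite ?inE//; [exact: measurable_box|exact: measurable_shell|].
move=> t tB; apply: eA; split => // i j.
have := tB j; rewrite /B/= in_itv/= (ord1 i) !mxE /ball/= => /andP[h1 h2].
by rewrite ltr_norml; apply/andP; split; lra.
Qed.

Lemma Rintegral_shell_gt0 (R0 R1 a b c : R) (f : R -> R) :
  0 < R0 -> R0 <= a -> a < b -> b <= R1 -> 0 < c ->
  bounded_measurable (@shell R n.+1 R0 R1) (fun t => f (radius t)) ->
  (forall r, r \in `]R0, R1[ -> 0 <= f r) ->
  (forall r, r \in `]a, b[ -> c <= f r) ->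
  0 < \int[lebesgue_tuple R n.+1]_(t in @shell R n.+1 R0 R1) f (radius t).
Proof.
move=> R0_gt0 R0a ab bR1 c0 bf f0 cf.
have mD := @measurable_shell R n.+1 R0 R1.
have fD := @shell_finite R n.+1 R0 R1.
have mS := @measurable_shell R n.+1 a b.
have fS := @shell_finite R n.+1 a b.
have sub : @shell R n.+1 a b `<=` @shell R n.+1 R0 R1.
  by move=> t /andP[h1 h2]; apply/andP; split; [exact: le_lt_trans h1|exact: lt_le_trans bR1].
pose h (t : n.+1.-tuple RT) : R := c * \1_(@shell R n.+1 a b) t.
have bh : bounded_measurable (@shell R n.+1 R0 R1) h.
  apply: bounded_measurableZ; split; first exact: measurable_funTS.
  by exists 1 => t _; rewrite indicE; case: (_ \in _); rewrite ?normr1 ?normr0.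
apply: (@lt_le_trans _ _ (\int[lebesgue_tuple R n.+1]_(t in @shell R n.+1 R0 R1) h t)).
  rewrite /Rintegral /h; under eq_integral do rewrite EFinM.
  rewrite integralZl//; last first.
    apply: bounded_measurable_integrable => //; split; first exact: measurable_funTS.
    by exists 1 => t _; rewrite indicE; case: (_ \in _); rewrite ?normr1 ?normr0.
  rewrite integral_indic// setIidl// fineM//; last by rewrite ge0_fin_numE.
  by rewrite mulr_gt0//= fine_gt0// shell_measure_gt0//= (lt_le_trans R0_gt0).
apply: le_Rintegral_bounded => // t tD; rewrite /h indicE.
have rin : radius t \in `]R0, R1[ by rewrite in_itv.
have [tS|tS] := boolP (t \in _); last by rewrite mulr0 f0.
by rewrite mulr1 cf// in_itv/=; move: tS; rewrite inE.
Qed.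

End shell_positive.

Lemma bounded_measurable_powR d (T : measurableType d) (R : realType)
    (D : set T) (F : T -> R) (p : R) : 0 <= p -> (forall x, 0 <= F x) ->
  bounded_measurable D F -> bounded_measurable D (fun x => F x `^ p).
Proof.
move=> p0 F0 [mF [M FM]]; split.
  exact: (measurableT_comp (measurable_powR p) mF).
exists (`|M| `^ p) => x Dx; rewrite ger0_norm ?powR_ge0//.
apply: ge0_ler_powR => //; rewrite ?nnegrE//.
by rewrite (le_trans (ler_norm _))// (le_trans (FM _ Dx))// ler_norm.
Qed.

Section perturbed_energy.
Variables (R : realType) (n : nat) (R0 R1 p : R).
Local Notation V := 'rV[R]_n.+1.
Local Notation N := (n.+1%:R : R).
Local Notation A := (@annulus R n.+1 R0 R1).
Local Notation D := (@shell R n.+1 R0 R1).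
Variables (u : V -> R) (g g' : R -> R).
Hypotheses (R0_gt0 : 0 < R0) (R01 : R0 < R1).
Hypotheses (u_C10 : C10 A u) (g_ge0 : forall r, r \in `[R0, R1] -> 0 <= g r).
Hypothesis u_profile : forall x, closure A x -> u x = g (enorm x).
Hypothesis u_partial : forall x i, A x ->
  partial i u x = g' (enorm x) * (x 0 i / enorm x).
Hypothesis bg : bounded_measurable D (fun t => g (radius t)).
Hypothesis bg' : bounded_measurable D (fun t => g' (radius t)).
Let J (F : n.+1.-tuple (measurableTypeR R) -> R) :=
  \int[lebesgue_tuple R n.+1]_(t in D) F t.
Let mD := @measurable_shell R n.+1 R0 R1.
Let fD := @shell_finite R n.+1 R0 R1.
Let q := @axial_ratio R n.+1 ord_max.
Let bq : bounded_measurable D q := @bounded_measurable_axial_ratio R n.+1 R0 R1 R0_gt0 ord_max.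
Local Notation v tau s := (axial_perturbation u tau s).

Let f1 r := g' r ^+ 2 + g r ^+ 2.
Let f2 r := g r ^+ 2 / r ^+ 2.
Let f3 r := `|g r| `^ p.

(** This integral and the next are [a] and [c] of the overview. The integral of u^p stays separate
    until the Nehari condition on [u] identifies it with [a]. *)
Definition dirichlet_energy := J (fun t => f1 (radius t)).
Definition hardy_energy := J (fun t => f2 (radius t)).
Definition power_energy := J (fun t => f3 (radius t)).
Local Notation a := dirichlet_energy.
Local Notation c := hardy_energy.
Local Notation b := power_energy.
(* The mean over the sphere of the square of the axial harmonic. *)
Definition harmonic_mean_sqr : R := (2 * N - 2) / (N + 2).
Local Notation m := harmonic_mean_sqr.

Lemma axial_sqr_ratio t : axial_sqr (rV_of_tuple t : V) = q t.
Proof. by rewrite /axial_sqr /q /axial_ratio -enorm_sumsq mxE. Qed.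

Let bf1 : bounded_measurable D (fun t => f1 (radius t)).
Proof. by apply: bounded_measurableD; exact: bounded_measurableX. Qed.

Let bf2 : bounded_measurable D (fun t => f2 (radius t)).
Proof.
by apply: bounded_measurableM; [exact: bounded_measurableX|exact: bounded_measurable_radiusV].
Qed.

Let N_neq0 : N != 0. Proof. by rewrite pnatr_eq0. Qed.

Let NN2_neq0 : N * (N + 2) != 0.
Proof. by rewrite mulf_neq0// lt0r_neq0// ltr_wpDl. Qed.

Let moment1 (f : R -> R) : (forall r, 0 <= f r) ->
  bounded_measurable D (fun t => f (radius t)) ->
  J (fun t => f (radius t) * q t) = J (fun t => f (radius t)) / N.
Proof.
move=> f0 bf; apply: (mulfI N_neq0); rewrite mulrCA divff// mulr1.
exact: Rintegral_axial_ratio.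
Qed.

Let moment2 (f : R -> R) : (forall r, 0 <= f r) ->
  bounded_measurable D (fun t => f (radius t)) ->
  J (fun t => f (radius t) * q t ^+ 2) =
  3 * J (fun t => f (radius t)) / (N * (N + 2)).
Proof.
move=> f0 bf; apply: (mulfI NN2_neq0); rewrite mulrCA divff// mulr1.
exact: Rintegral_axial_ratio_sqr.
Qed.

Let DA t : D t -> A (rV_of_tuple t). Proof. by []. Qed.

Let quadratic_integrand tau s t : D t ->
  sqgrad (v tau s) (rV_of_tuple t) + v tau s (rV_of_tuple t) ^+ 2 =
  tau ^+ 2 * (1 + s) ^+ 2 * f1 (radius t) +
  (- (tau ^+ 2 * (2 * s * (1 + s) * N)) * (f1 (radius t) * q t) +
  (tau ^+ 2 * (s ^+ 2 * N ^+ 2) * (f1 (radius t) * q t ^+ 2) +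
  (tau ^+ 2 * (4 * s ^+ 2 * N ^+ 2) * (f2 (radius t) * q t) +
   - (tau ^+ 2 * (4 * s ^+ 2 * N ^+ 2)) * (f2 (radius t) * q t ^+ 2)))).
Proof.
move=> /DA At; rewrite (sqgrad_axial_perturbation (g := g) (g' := g') (R0 := R0) (R1 := R1))//.
rewrite /axial_perturbation /axial_harmonic axial_sqr_ratio u_profile//; last first.
  exact: annulus_sub_closure.
rewrite -/(radius t) /f1 /f2; ring.
Qed.

Let bfq f : bounded_measurable D (fun t => f (radius t)) ->
  bounded_measurable D (fun t => f (radius t) * q t).
Proof. by move=> bf; exact: bounded_measurableM. Qed.

Let bfq2 f : bounded_measurable D (fun t => f (radius t)) ->
  bounded_measurable D (fun t => f (radius t) * q t ^+ 2).
Proof. by move=> bf; apply: bounded_measurableM => //; exact: bounded_measurableX. Qed.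

Lemma bounded_measurable_eq (F G : n.+1.-tuple (measurableTypeR R) -> R) :
  (forall t, D t -> F t = G t) -> bounded_measurable D F -> bounded_measurable D G.
Proof.
move=> FG [mF [M FM]]; split.
  by apply: eq_measurable_fun mF => t; rewrite inE; exact: FG.
by exists M => t Dt; rewrite -FG//; exact: FM.
Qed.

Let bounded_measurable_quadratic_integrand tau s : bounded_measurable D
  (fun t => tau ^+ 2 * (1 + s) ^+ 2 * f1 (radius t) +
  (- (tau ^+ 2 * (2 * s * (1 + s) * N)) * (f1 (radius t) * q t) +
  (tau ^+ 2 * (s ^+ 2 * N ^+ 2) * (f1 (radius t) * q t ^+ 2) +
  (tau ^+ 2 * (4 * s ^+ 2 * N ^+ 2) * (f2 (radius t) * q t) +
   - (tau ^+ 2 * (4 * s ^+ 2 * N ^+ 2)) * (f2 (radius t) * q t ^+ 2))))).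
Proof.
have [b1 b2] := (bfq bf1, bfq bf2); have [b3 b4] := (bfq2 bf1, bfq2 bf2).
by do 4!(apply: bounded_measurableD; first exact: bounded_measurableZ);
  exact: bounded_measurableZ.
Qed.

Lemma bounded_measurable_quadratic tau s : bounded_measurable D (fun t =>
  sqgrad (v tau s) (rV_of_tuple t) + v tau s (rV_of_tuple t) ^+ 2).
Proof.
apply: bounded_measurable_eq (bounded_measurable_quadratic_integrand tau s).
by move=> t Dt; rewrite quadratic_integrand.
Qed.

(** Over spheres q has mean 1 / N and q^2 has mean 3 / (N (N + 2)). Hence Y = 1 - N q has mean 0,
    which removes the term linear in s, and Y^2 has mean m = 1 - 2 + 3 N / (N + 2). The tangential
    gradient contributes 4 N^2 times the mean (N - 1) / (N (N + 2)) of q - q^2, which is 2 N m. *)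
Lemma integral_quadratic tau s :
  integral_rV A (fun x => sqgrad (v tau s) x + v tau s x ^+ 2) =
  tau ^+ 2 * (a + s ^+ 2 * (m * (a + 2 * N * c))).
Proof.
rewrite /integral_rV (_ : @rV_of_tuple R n.+1 @^-1` A = D)//.
rewrite (@eq_Rintegral _ _ _ _ D (fun t =>
  tau ^+ 2 * (1 + s) ^+ 2 * f1 (radius t) +
  (- (tau ^+ 2 * (2 * s * (1 + s) * N)) * (f1 (radius t) * q t) +
  (tau ^+ 2 * (s ^+ 2 * N ^+ 2) * (f1 (radius t) * q t ^+ 2) +
  (tau ^+ 2 * (4 * s ^+ 2 * N ^+ 2) * (f2 (radius t) * q t) +
   - (tau ^+ 2 * (4 * s ^+ 2 * N ^+ 2)) * (f2 (radius t) * q t ^+ 2)))))); last first.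
  by move=> t; rewrite inE => Dt; exact: quadratic_integrand.
have [b1 b2] := (bfq bf1, bfq bf2); have [b3 b4] := (bfq2 bf1, bfq2 bf2).
have z0 := bounded_measurableZ (tau ^+ 2 * (1 + s) ^+ 2) bf1.
have z1 := bounded_measurableZ (- (tau ^+ 2 * (2 * s * (1 + s) * N))) b1.
have z2 := bounded_measurableZ (tau ^+ 2 * (s ^+ 2 * N ^+ 2)) b3.
have z3 := bounded_measurableZ (tau ^+ 2 * (4 * s ^+ 2 * N ^+ 2)) b2.
have z4 := bounded_measurableZ (- (tau ^+ 2 * (4 * s ^+ 2 * N ^+ 2))) b4.
have w3 := bounded_measurableD z3 z4.
have w2 := bounded_measurableD z2 w3.
have w1 := bounded_measurableD z1 w2.
rewrite (RintegralD_bounded mD fD z0 w1) (RintegralD_bounded mD fD z1 w2).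
rewrite (RintegralD_bounded mD fD z2 w3) (RintegralD_bounded mD fD z3 z4).
rewrite !RintegralZ_bounded//.
have f10 r : 0 <= f1 r by rewrite addr_ge0 ?sqr_ge0.
have f20 r : 0 <= f2 r by rewrite divr_ge0 ?sqr_ge0.
have := moment1 f10 bf1; have := moment2 f10 bf1.
have := moment1 f20 bf2; have := moment2 f20 bf2.
rewrite /J => -> -> -> ->; rewrite /a /c /J /m.
have N2 : N + 2 != 0 by rewrite lt0r_neq0// ltr_wpDl.
by move: (N) N2 N_neq0 => K K2 K0; field; rewrite K2 K0.
Qed.

Lemma power_integrand tau s t : 0 <= tau -> 0 <= s -> s * N <= 1 -> D t ->
  `|v tau s (rV_of_tuple t)| `^ p =
  tau `^ p * (f3 (radius t) * (1 + (s - s * N * q t)) `^ p).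
Proof.
move=> t0 s0 sN Dt; rewrite /axial_perturbation u_profile//; last first.
  exact/annulus_sub_closure/DA.
have Y0 := axial_factor_ge0 s0 sN (rV_of_tuple t : V).
have YE : 1 + s * axial_harmonic (rV_of_tuple t : V) = 1 + (s - s * N * q t).
  by rewrite /axial_harmonic axial_sqr_ratio; ring.
rewrite !normrM (ger0_norm t0) (ger0_norm Y0) powRM ?mulr_ge0//.
by rewrite powRM// YE.
Qed.

Hypothesis p_ge2 : 2 <= p.

Let bf3 : bounded_measurable D (fun t => f3 (radius t)).
Proof.
apply: bounded_measurable_powR; [exact: le_trans p_ge2|by []|].
case: bg => mg [M gM]; split; first exact: measurableT_comp.
by exists M => t Dt; rewrite normr_id; exact: gM.
Qed.

Let bfac s : 0 <= s -> s * N <= 1 -> bounded_measurable D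
  (fun t => f3 (radius t) * (1 + (s - s * N * q t)) `^ p).
Proof.
move=> s0 sN; apply: bounded_measurableM => //.
have h : bounded_measurable D (fun t => `|1 + (s - s * N * q t)|).
  have : bounded_measurable D (fun t => 1 + (s + - (s * N) * q t)).
    apply: bounded_measurableD; first exact: bounded_measurable_cst.
    by apply: bounded_measurableD; [exact: bounded_measurable_cst|exact: bounded_measurableZ].
  move=> [mF [M FM]]; split.
    apply: measurableT_comp => //.
    by under eq_fun do rewrite -mulNr.
  by exists M => t Dt; rewrite normr_id -mulNr; exact: FM.
have := bounded_measurable_powR (le_trans (ler0n _ 2) p_ge2) (fun t => normr_ge0 _) h.
apply: bounded_measurable_eq => t Dt; rewrite ger0_norm//.
have := axial_factor_ge0 s0 sN (rV_of_tuple t : V).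
by rewrite /axial_harmonic axial_sqr_ratio mulrBr mulr1 mulrA.
Qed.

Lemma bounded_measurable_power tau s : 0 <= tau -> 0 <= s -> s * N <= 1 ->
  bounded_measurable D (fun t => `|v tau s (rV_of_tuple t)| `^ p).
Proof.
move=> t0 s0 sN; have := bounded_measurableZ (tau `^ p) (bfac s0 sN).
by apply: bounded_measurable_eq => t Dt; rewrite power_integrand.
Qed.

Lemma integral_power tau s : 0 <= tau -> 0 <= s -> s * N <= 1 ->
  integral_rV A (fun x => `|v tau s x| `^ p) =
  tau `^ p * integral_rV A (fun x => `|v 1 s x| `^ p).
Proof.
move=> t0 s0 sN; rewrite /integral_rV (_ : @rV_of_tuple R n.+1 @^-1` A = D)//.
rewrite -RintegralZ_bounded//; last exact: bounded_measurable_power.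
apply: eq_Rintegral => t; rewrite inE => Dt.
by rewrite !power_integrand// powR1 mul1r.
Qed.

(** As |Y| <= N, the condition s N <= d puts s Y in the range of the scalar inequality at every
    point. Integrating that inequality against u^p leaves only the quadratic term, the mean of Y
    being 0. *)
Lemma integral_power_ge k d s : 0 < d < 1 -> 0 <= s -> s * N <= d ->
  (forall x, `|x| <= d -> 1 + p * x + k * x ^+ 2 <= (1 + x) `^ p) ->
  b * (1 + k * m * s ^+ 2) <= integral_rV A (fun x => `|v 1 s x| `^ p).
Proof.
move=> /andP[d0 d1] s0 sNd taylor; have sN : s * N <= 1 by rewrite (le_trans sNd)// ltW.
rewrite /integral_rV (_ : @rV_of_tuple R n.+1 @^-1` A = D)//.
have f30 r : 0 <= f3 r by exact: powR_ge0.
have b1 := bfq bf3; have b2 := bfq2 bf3.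
have z0 := bounded_measurableZ (1 + p * s + k * s ^+ 2) bf3.
have z1 := bounded_measurableZ (- (p * s * N + 2 * k * s ^+ 2 * N)) b1.
have z2 := bounded_measurableZ (k * s ^+ 2 * N ^+ 2) b2.
have w1 := bounded_measurableD z1 z2.
have -> : b * (1 + k * m * s ^+ 2) = J (fun t => (1 + p * s + k * s ^+ 2) * f3 (radius t) +
    (- (p * s * N + 2 * k * s ^+ 2 * N) * (f3 (radius t) * q t) +
     k * s ^+ 2 * N ^+ 2 * (f3 (radius t) * q t ^+ 2))).
  rewrite /J (RintegralD_bounded mD fD z0 w1) (RintegralD_bounded mD fD z1 z2).
  rewrite !RintegralZ_bounded//.
  have := moment1 f30 bf3; have := moment2 f30 bf3; rewrite /J => -> ->.
  rewrite /b /J /m; have N2 : N + 2 != 0 by rewrite lt0r_neq0// ltr_wpDl.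
  by move: (N) N2 N_neq0 => K K2 K0; field; rewrite K2 K0.
apply: le_Rintegral_bounded => //.
- exact: bounded_measurableD.
- exact: bounded_measurable_power.
move=> t Dt; rewrite power_integrand// powR1 mul1r.
have qE := axial_sqr_ratio t.
have q0 : 0 <= q t by rewrite -qE; exact: axial_sqr_ge0.
have q1 : q t <= 1 by rewrite -qE; exact: axial_sqr_le1.
have N1 : 1 <= N by rewrite ler1n.
have y_le : `|s - s * N * q t| <= d.
  have sN0 : 0 <= s * N by rewrite mulr_ge0.
  have sNq : s * N * q t <= s * N by rewrite ler_piMr.
  have ssN : s <= s * N by rewrite ler_peMr.
  have sNq0 : 0 <= s * N * q t by rewrite mulr_ge0.
  by rewrite ler_norml; apply/andP; split; lra.
have := ler_wpM2l (f30 (radius t)) (taylor _ y_le).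
by apply: le_trans; rewrite le_eqVlt; apply/orP; left; apply/eqP; ring.
Qed.

End perturbed_energy.

(** * Scaling onto the Nehari set and choice of parameters *)

(** [tau] is the positive root of tau^2 a y = tau^p P. The last claim, tau^2 < 1 / y, amounts to a y
    / P < y^(1 - p / 2), that is y^(p / 2) < P / a, which follows from y^(p / 2) < w <= P / a. *)
Lemma nehari_scaling (R : realType) (p a y w P : R) :
  2 < p -> 0 < a -> 0 < y -> y `^ (p / 2) < w -> a * w <= P ->
  let tau := (a * y / P) `^ (p - 2)^-1 in
  [/\ 0 < tau, tau ^+ 2 * (a * y) = tau `^ p * P & tau ^+ 2 * (a * y) < a].
Proof.
move=> p2 a0 y0 yw wP tau; have p20 : 0 < p - 2 by rewrite subr_gt0.
have yq : 0 < y `^ (p / 2) by exact: powR_gt0.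
have w0 : 0 < w := lt_trans yq yw.
have P0 : 0 < P by apply: lt_le_trans wP; exact: mulr_gt0.
have x0 : 0 < a * y / P by rewrite divr_gt0// mulr_gt0.
have tau0 : 0 < tau by exact: powR_gt0.
have tauE : tau `^ (p - 2) = a * y / P.
  by rewrite /tau -powRrM mulVf ?gt_eqF// powRr1// ltW.
have tau2 : tau ^+ 2 = tau `^ 2 by rewrite powR_mulrn// ltW.
split => //.
  have -> : p = (p - 2) + 2 by rewrite subrK.
  rewrite powRD ?(gt_eqF tau0) ?implybT// tauE -tau2.
  by field; rewrite gt_eqF.
have lt1 : a * y / P < y `^ (1 - p / 2).
  rewrite powRB ?(gt_eqF y0) ?implybT// powRr1 ?(ltW y0)//.
  apply: (@le_lt_trans _ _ (y / w)).
    rewrite ler_pdivrMr// mulrAC ler_pdivlMr// mulrC mulrA [w * a]mulrC.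
    by rewrite [leRHS]mulrC ler_pM2r.
  by rewrite ltr_pM2l// ltf_pV2.
have tau_lt : tau ^+ 2 < y^-1.
  rewrite tau2 /tau -powRrM.
  have -> : y^-1 = (y `^ (1 - p / 2)) `^ ((p - 2)^-1 * 2).
    rewrite -powRrM (_ : _ * _ = - 1) ?powRN ?powRr1 ?(ltW y0)//.
    by field; rewrite gt_eqF.
  apply: gt0_ltr_powR => //; rewrite ?nnegrE ?(ltW x0) ?powR_ge0//.
  by rewrite mulr_gt0// invr_gt0.
have : tau ^+ 2 * (a * y) < y^-1 * (a * y) by rewrite ltr_pM2r// mulr_gt0.
by rewrite [X in _ < X]mulrCA mulVf ?gt_eqF// mulr1.
Qed.

(** With B = 1 + 2 N c / a, the gap hypothesis is B < p - 1. It leaves room for a coefficient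
    strictly between p B / 2, needed to beat the quadratic part, and p (p - 1) / 2, the limit of the
    Taylor inequality. *)
Lemma variation_parameters (R : realType) (p N m a c : R) :
  2 < p -> 0 < N -> 0 < m -> 0 < a -> 0 <= c -> 2 * N * c < (p - 2) * a ->
  exists k d s : R,
  [/\ 0 < d < 1, 0 < s, s * N <= d,
      forall x, `|x| <= d -> 1 + p * x + k * x ^+ 2 <= (1 + x) `^ p &
      (1 + m * (1 + 2 * N * c / a) * s ^+ 2) `^ (p / 2) < 1 + k * m * s ^+ 2].
Proof.
move=> p2 N0 m0 a0 c0 gap; pose B := 1 + 2 * N * c / a.
have p_gt0 : 0 < p by exact: lt_trans p2.
have Nca : 2 * N * c / a < p - 2 by rewrite ltr_pdivrMr.
have Nca0 : 0 <= 2 * N * c / a.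
  by rewrite divr_ge0 ?(ltW a0)// !mulr_ge0// ltW.
have Bp : B < p - 1 by rewrite /B; lra.
have B1 : 1 <= B by rewrite lerDl.
have al0 : 0 < m * B by rewrite mulr_gt0// (lt_le_trans ltr01).
(* The midpoint of p B / 2 and p (p - 1) / 2. *)
pose k := p * (B + (p - 1)) / 4.
have k0 : 0 < k by rewrite divr_gt0// mulr_gt0//; lra.
have kp : k < p * (p - 1) / 2.
  have -> : p * (p - 1) / 2 = p * ((p - 1) + (p - 1)) / 4 by field.
  by rewrite ltr_pM2r// ltr_pM2l// ltrD2r.
have kq : p / 2 * (m * B) < k * m.
  have -> : p / 2 * (m * B) = p * (B + B) / 4 * m by field.
  by rewrite ltr_pM2r// ltr_pM2r// ltr_pM2l// ltrD2l.
have [d d01 taylor] := powR_taylor2 (ltW p2) k0 kp; have /andP[d0 d1] := d01.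
have q0 : 0 < p / 2 by rewrite divr_gt0.
have [e e0 gapP] := powR_gap q0 al0 kq.
(* Halving [e] makes the required inequality s < e strict. *)
exists k, d, (Num.min (d / N) (e / 2)).
have s0 : 0 < Num.min (d / N) (e / 2) by rewrite lt_min !divr_gt0.
split => //; first by rewrite -ler_pdivlMr// ge_min lexx.
apply: gapP; rewrite s0/= gt_min; apply/orP; right.
by rewrite ltr_pdivrMr// ltr_pMr// ltr1n.
Qed.

(** * The strict Hardy inequality for radial profiles *)

Section radial_hardy_gap.
Variables (R : realType) (n : nat) (R0 R1 : R) (g g' : R -> R).
Hypotheses (R0_gt0 : 0 < R0) (R01 : R0 < R1).
Hypotheses (cg : {within `[R0, R1], continuous g})
  (cg' : {within `[R0, R1], continuous g'}).
Hypothesis dg : forall r, r \in `]R0, R1[ -> is_derive r (1 : R) g (g' r).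
Hypotheses (gR0 : g R0 = 0) (gR1 : g R1 = 0).
Hypothesis g_ge0 : forall r, r \in `[R0, R1] -> 0 <= g r.
Local Notation N := (n.+1%:R : R).
Local Notation D := (@shell R n.+1 R0 R1).
Local Notation J F := (\int[lebesgue_tuple R n.+1]_(t in D) F t).
Let mD := @measurable_shell R n.+1 R0 R1.
Let fD := @shell_finite R n.+1 R0 R1.
Let bg := bounded_measurable_profile n R01 cg.
Let bg' := bounded_measurable_profile n R01 cg'.
Let bg2 : bounded_measurable D (fun t => g (radius t) ^+ 2) :=
  bounded_measurableX 2 bg.
Let bf2 : bounded_measurable D (fun t => g (radius t) ^+ 2 / radius t ^+ 2).
Proof. by apply: bounded_measurableM => //; exact: bounded_measurable_radiusV. Qed.

(** The difference of the two sides is the integral of g^2 (1 - R0^2 / r^2), which is nonnegative.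
    It is bounded below on a short interval to the right of [r0]: there g > g(r0) / 2 by continuity,
    and 1 - R0^2 / r^2, being increasing, exceeds its value at [r0]. *)
Lemma hardy_energy_lt r0 : r0 \in `[R0, R1] -> g r0 != 0 ->
  R0 ^+ 2 * hardy_energy n R0 R1 g < J (fun t => g (radius t) ^+ 2).
Proof.
move=> r_in gr0.
pose f r := g r ^+ 2 + - R0 ^+ 2 * (g r ^+ 2 / r ^+ 2).
have fE r : 0 < r -> f r = g r ^+ 2 * (1 - R0 ^+ 2 / r ^+ 2).
  by move=> r_pos; rewrite /f; field; rewrite gt_eqF.
have r0_in : r0 \in `]R0, R1[.
  have n0 : r0 != R0 by apply: contraNneq gr0 => ->; rewrite gR0.
  have n1 : r0 != R1 by apply: contraNneq gr0 => ->; rewrite gR1.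
  by move: r_in; rewrite !in_itv/= !lt_neqAle n1 eq_sym n0.
have gr0_gt0 : 0 < g r0 by rewrite lt0r gr0 g_ge0.
have cgr0 : {for r0, continuous g}.
  by apply: differentiable_continuous; apply/derivable1_diffP; case: (dg r0_in).
have half : g r0 / 2 < g r0 by lra.
have near1 := cvgr_gt _ cgr0 _ half.
have near2 : \forall r \near r0, r \in `]R0, R1[ by exact: near_in_itvoo.
have /nbhs_ballP[e /= e0 he] : \forall r \near r0, g r0 / 2 < g r /\ r \in `]R0, R1[.
  by near=> r; split; near: r; [exact: near1|exact: near2].
have R0r0 : R0 < r0 by move: r0_in; rewrite in_itv/= => /andP[].
have r0_gt0 := lt_trans R0_gt0 R0r0.
have one r : R0 < r -> 0 < 1 - R0 ^+ 2 / r ^+ 2.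
  move=> R0r; have r_gt0 := lt_trans R0_gt0 R0r.
  by rewrite subr_gt0 ltr_pdivrMr ?exprn_gt0// mul1r ltrXn2r// ?nnegrE ltW.
have bR1 : r0 + e / 2 <= R1.
  have [_] : g r0 / 2 < g (r0 + e / 2) /\ r0 + e / 2 \in `]R0, R1[.
    by apply: he; rewrite /ball/= opprD addNKr normrN gtr0_norm; lra.
  by rewrite in_itv/= => /andP[_ /ltW].
have bf : bounded_measurable (@shell R n.+1 R0 R1) (fun t => f (radius t)).
  by apply: bounded_measurableD => //; exact: bounded_measurableZ.
have : 0 < \int[lebesgue_tuple R n.+1]_(t in @shell R n.+1 R0 R1) f (radius t).
  apply: (@Rintegral_shell_gt0 R n R0 R1 r0 (r0 + e / 2)
    ((g r0 / 2) ^+ 2 * (1 - R0 ^+ 2 / r0 ^+ 2))) => //.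
  - exact: ltW.
  - lra.
  - by rewrite mulr_gt0 ?one// exprn_gt0//; lra.
  - move=> r; rewrite in_itv/= => /andP[R0r _].
    by rewrite fE ?(lt_trans R0_gt0)// mulr_ge0 ?sqr_ge0// ltW// one.
  - move=> r; rewrite in_itv/= => /andP[r0r rb].
    have r_gt0 := lt_trans r0_gt0 r0r.
    have [h _] : g r0 / 2 < g r /\ r \in `]R0, R1[.
      by apply: he; rewrite /ball/= ltr_norml; apply/andP; split; lra.
    have sq : (g r0 / 2) ^+ 2 <= g r ^+ 2 by rewrite ler_pXn2r ?nnegrE//; lra.
    have inv : 1 - R0 ^+ 2 / r0 ^+ 2 <= 1 - R0 ^+ 2 / r ^+ 2.
      rewrite lerD2l lerN2 ler_pM2l ?exprn_gt0// lef_pV2 ?posrE ?exprn_gt0//.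
      by rewrite ler_pXn2r// ?nnegrE ltW.
    by rewrite fE//; apply: ler_pM => //; [exact: sqr_ge0|exact/ltW/one].
by rewrite /f RintegralD_bounded// ?RintegralZ_bounded//; [rewrite mulNr subr_gt0|exact: bounded_measurableZ].
Unshelve. all: by end_near. Qed.

(** Here [p] stands for the exponent of the equation minus 2. Hardy's inequality bounds the gradient
    term, and the strict comparison with R0^2 c bounds the term in g^2, so that a non-strict bound
    on the exponent yields a strict gap. *)
Lemma radial_hardy_gap p r0 : r0 \in `[R0, R1] -> g r0 != 0 -> 0 < p ->
  2 * N <= p * (((N - 2) / 2) ^+ 2 + R0 ^+ 2) ->
  2 * N * hardy_energy n R0 R1 g < p * dirichlet_energy n R0 R1 g g'.
Proof.
move=> r_in gr0 p0 h1; have [M g'M] := continuous_itv_bounded R01 cg'.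
have g'M' r : r \in `]R0, R1[ -> `|g' r| <= M.
  by rewrite in_itv/= => /andP[h h']; apply: g'M; rewrite in_itv/= !ltW.
have hardy := hardy_shell R0_gt0 R01 cg dg gR0 gR1 g'M' bg bg'.
have c0 : 0 <= hardy_energy n R0 R1 g.
  by apply: Rintegral_ge0 => t _; rewrite divr_ge0 ?sqr_ge0.
apply: (le_lt_trans (ler_wpM2r c0 h1)); rewrite -mulrA ltr_pM2l//.
rewrite /dirichlet_energy RintegralD_bounded//; last exact: bounded_measurableX.
by rewrite mulrDl; apply: ler_ltD => //; exact: hardy_energy_lt gr0.
Qed.

End radial_hardy_gap.

Theorem theorem1p2 (R : realType) (n : nat) (R0 R1 p : R)
    (u : 'rV[R]_n.+1 -> R) :
  (3 <= n.+1)%N ->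
  0 < R0 -> R0 < R1 ->
  2 + 2 * n.+1%:R / (((n.+1%:R - 2) / 2) ^+ 2 + R0 ^+ 2) <= p ->
  K_ground_state p R0 R1 u ->
  ~ radial (closure (annulus R0 R1)) u.
Proof.
move=> n3 R0_gt0 R01 hp [[[uC10 u_ge0 _] [x0 x0A ux0] uneh] umin] urad.
have [g [g' [cg cg' dg [gR0 gR1] [ug up]]]] := radial_C10_profile R0_gt0 R01 uC10 urad.
have g_ge0 r : r \in `[R0, R1] -> 0 <= g r.
  move=> rin; have [x xA <-] := closure_annulus_enorm n R0_gt0 R01 rin.
  by rewrite -ug//; exact: u_ge0.
have bg := bounded_measurable_profile n R01 cg.
have bg' := bounded_measurable_profile n R01 cg'.
pose N : R := n.+1%:R; have N0 : 0 < N by rewrite ltr0n.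
pose c := hardy_energy n R0 R1 g.
pose a := dirichlet_energy n R0 R1 g g'.
pose m := harmonic_mean_sqr R n.
have c0 : 0 <= c by apply: Rintegral_ge0 => t _; rewrite divr_ge0 ?sqr_ge0.
have K0 : 0 < ((N - 2) / 2) ^+ 2 + R0 ^+ 2 by rewrite ltr_wpDl ?sqr_ge0// exprn_gt0.
have p2 : 2 < p by apply: lt_le_trans hp; rewrite ltrDl divr_gt0// mulr_gt0.
have p20 : 0 < p - 2 by rewrite subr_gt0.
have p_ge2 := ltW p2; have p_gt0 : 0 < p by exact: lt_trans p2.
have gap : 2 * N * c < (p - 2) * a.
  apply: (radial_hardy_gap R0_gt0 R01 cg cg' dg gR0 gR1 g_ge0 (r0 := enorm x0)) => //.
  - by move: x0A; rewrite closure_annulus.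
  - by rewrite -ug.
  - by rewrite -ler_pdivrMr// lerBrDl.
have a0 : 0 < a.
  by rewrite -(pmulr_rgt0 _ p20); apply: le_lt_trans gap; rewrite !mulr_ge0// ltW.
have m0 : 0 < m.
  apply: divr_gt0; last by rewrite ltr_wpDl.
  by rewrite subr_gt0 ltr_pMr// ltr1n (leq_trans _ n3).
pose al := m * (1 + 2 * N * c / a).
pose P1 s := integral_rV (annulus R0 R1) (fun x => `|axial_perturbation u 1 s x| `^ p).
have quad tau s : integral_rV (annulus R0 R1)
    (fun x => sqgrad (axial_perturbation u tau s) x + axial_perturbation u tau s x ^+ 2) =
    tau ^+ 2 * (a * (1 + al * s ^+ 2)).
  rewrite (integral_quadratic R0_gt0 R01 uC10 ug up bg bg' tau s) -/a -/c -/m -/N.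
  by rewrite /al; field; rewrite gt_eqF.
have pow tau s : 0 <= tau -> 0 <= s -> s * N <= 1 ->
    integral_rV (annulus R0 R1) (fun x => `|axial_perturbation u tau s x| `^ p) =
    tau `^ p * P1 s.
  exact: (integral_power R0_gt0 ug bg p_ge2).
have ray tau s : 0 <= tau -> 0 <= s -> s * N <= 1 ->
    is_denergy p (annulus R0 R1) (axial_perturbation u tau s) (axial_perturbation u tau s)
      (tau ^+ 2 * (a * (1 + al * s ^+ 2)) - tau `^ p * P1 s).
  move=> t0 s0 sN; rewrite -quad -pow//; apply: is_denergy_ray => //.
  - by have [[_ + _] _] := C10_axial_perturbation tau s R0_gt0 R01 uC10.
  - exact: (bounded_measurable_quadratic R0_gt0 R01 uC10 ug up bg bg').
  - exact: (bounded_measurable_power R0_gt0 ug bg p_ge2).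
have energyE tau s : 0 <= tau -> 0 <= s -> s * N <= 1 ->
    energy p (annulus R0 R1) (axial_perturbation u tau s) =
    2^-1 * (tau ^+ 2 * (a * (1 + al * s ^+ 2))) - p^-1 * (tau `^ p * P1 s).
  by move=> t0 s0 sN; rewrite /energy quad pow.
(* [u] belongs to the family, so the formulas [ray] and [energyE] apply to it too. *)
have u10 : axial_perturbation u 1 0 = u.
  by apply/funext => x; rewrite /axial_perturbation mul1r mul0r addr0 mulr1.
have z0 : 0 * N <= 1 by rewrite mul0r.
(* The derivative of the energy along the ray through [u] is a - P1 0 by the formula and 0 by the
   Nehari condition. *)
have aP : a = P1 0.
  have := ray 1 0 ler01 (lexx _) z0; rewrite u10 => -[_ E].
  move: uneh => [_]; rewrite E expr1n powR1 expr0n mulr0 addr0 mulr1 !mul1r => /eqP.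
  by rewrite subr_eq0 => /eqP.
have P0E : P1 0 = power_energy n R0 R1 p g.
  rewrite /P1 u10; apply: eq_Rintegral => t; rewrite inE => Dt.
  by rewrite ug//; exact: annulus_sub_closure.
have [k [d [s [d01 s0 sN taylor gap_s]]]] := variation_parameters p2 N0 m0 a0 c0 gap.
have s_ge0 := ltW s0.
have sN1 : s * N < 1 by apply: le_lt_trans sN _; case/andP: d01.
have sN1' := ltW sN1.
have Pge : a * (1 + k * m * s ^+ 2) <= P1 s.
  rewrite aP P0E.
  exact: (integral_power_ge R0_gt0 ug bg p_ge2 d01 s_ge0 sN taylor).
have y0 : 0 < 1 + al * s ^+ 2.
  rewrite ltr_wpDr// mulr_ge0 ?sqr_ge0// mulr_ge0 ?(ltW m0)// addr_ge0//.
  by rewrite divr_ge0 ?(ltW a0)// !mulr_ge0// ltW.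
have [] := nehari_scaling p2 a0 y0 gap_s Pge.
set tau := _ `^ _ => tau0 tauN tau_lt; have tau_ge0 := ltW tau0.
have Y0 : 1 + s * axial_harmonic x0 != 0.
  rewrite gt_eqF// (lt_le_trans s0)//; exact: axial_factor_ge.
have neh : nehariK p R0 R1 (axial_perturbation u tau s).
  split.
  - exact: (coneK_axial_perturbation R0_gt0 R01 uC10 g_ge0 ug).
  - by exists x0 => //; apply: mulf_neq0; [rewrite gt_eqF|exact: mulf_neq0].
  - by have := ray tau s tau_ge0 s_ge0 sN1'; rewrite tauN subrr.
(* On the Nehari set the two integrals coincide, so both energies are 1/2 - 1/p times their
   quadratic parts, which [tau_lt] orders strictly against minimality. *)
have := umin _ neh; rewrite -{1}u10 (energyE 1 0)// (energyE tau s)//.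
rewrite -aP -tauN expr1n powR1 expr0n mulr0 addr0 mulr1 !mul1r.
have p_inv : p^-1 < 2^-1 by rewrite ltf_pV2// posrE.
move: tau_lt; set X := tau ^+ 2 * _ => Xa; rewrite leNgt => /negP; apply.
by rewrite -!mulrBl ltr_pM2l// subr_gt0.
Qed.
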